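(* For any $0\le k\le n-1$, the type $(1,1)$ categorical Gromov-Witten invariant of $A_n$ satisfies $\langle[\epsilon|\epsilon^k]\rangle^{A_n}_{1,1}=0$.
   Context: $\mathbb{K}$ is a field of characteristic $0$, $n\ge1$. Shifted sign conventions are used for $A_\infty$ algebras and signs $\pm$ are Koszul signs. $A_n=\mathrm{span}(\mathbf 1,\epsilon)$ is the $\mathbb{Z}/2\mathbb{Z}$-graded cyclic $A_\infty$ algebra with $\mathbf 1$ even and a strict unit, $\epsilon$ odd, only other non-zero operation $\mu_{n+1}(\epsilon,\dots,\epsilon)=\frac1{n+1}\mathbf 1$, and odd pairing $\langle\mathbf 1,\epsilon\rangle=1$. It is the minimal model of the category of matrix factorizations of $\frac1{n+1}x^{n+1}$. **Chains.** $L:=CC_{*+1}(A_n)$ is the shifted reduced Hochschild chain complex (unit killed in all slots but the $0$-th), with basis $\mathbf 1|\epsilon^k,\ \epsilon|\epsilon^k$ ($k\ge0$ copies of $\epsilon$ after the bar), $b(\mathbf 1|\epsilon^k)=0$, $b(\epsilon|\epsilon^k)=0$ for $k<n$ and $\mathbf 1|\epsilon^{k-n}$ for $k\ge n$, $B(\mathbf 1|\epsilon^k)=0$, $B(\epsilon|\epsilon^k)=(k+1)\mathbf 1|\epsilon^{k+1}$. Its homology has basis $[\epsilon|\epsilon^k]$, $0\le k\le n-1$. **Graph operations.** Put $c(a_1,\dots,a_{k+1})=\langle\mu_k(a_1,\dots,a_k),a_{k+1}\rangle$, $\{e_s\}$ a basis of $A_n$ and $\{e^s\}$ its dual basis. -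 Mukai pairing: $\langle a_0|\cdots|a_i,b_0|\cdots|b_j\rangle_{\rm Muk}=\sum\pm c(a_{q+1},..,a_i,a_0,..,a_p,e_s,b_{p'+1},..,b_{q'},e_t)\,c(b_{q'+1},..,b_j,b_0,..,b_{p'},e^s,a_{p+1},..,a_q,e^t)$ over $0\le p\le q\le i$, $0\le p'\le q'\le j$, $s,t$. - Coproduct: $\Delta(a_0|\cdots|a_k)=\sum\pm c(a_{l+1},..,a_k,a_0,..,a_r,e_p,a_{s+1},..,a_t,e_q)\,(e^p|a_{r+1}|\cdots|a_s)\otimes(e^q|a_{t+1}|\cdots|a_l)$ over $0\le r\le s\le t\le l\le k$ and $p,q$. - For a ribbon graph $G$ with one face and one leg (''input'') and no output, $\rho(G)(a_0|\cdots|a_k)$ is the signed sum, over all ways of placing $a_1,\dots,a_k$ in order in the corners met when going once around the face starting from the leg, of the contraction along the edges (by $\sum_s e_s\otimes e^s$) of the tensors $c$ put at the vertices, with $a_0$ on the leg. Let $G_2$ be the trivalent genus-one graph with edges $x,y,z,w$ and vertices with cyclic orders $(\mathrm{leg},x,z)$, $(y,w,z)$, $(w,x,y)$, and $G_3$ the graph with edges $x,w$ and one vertex with cyclic order $(\mathrm{leg},x,w,x,w)$. These operations are the action of the Kontsevich-Soibelman/Costello PROP of ribbon graph chains on moduli of curves with parametrized boundaries; trivalent graphs are oriented so as to represent the positive generator (class of a point) of $H_0$ of the corresponding moduli space, and the action is compatible with gluing. **Splitting.** Lift $[\epsilon|\epsilon^k]$ ($0\le k\le n-1$) to $\widetilde{\epsilon|\epsilon^k}=\sum_{l\ge0}(-1)^lc_{k,l}\,\epsilon|\epsilon^{k+nl+l}u^l\in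 L[[u]]$, $c_{k,0}=1$, $c_{k,l}=\prod_{j=0}^{l-1}(k+1+j(n+1))$; these are $(b+uB)$-closed. **Deformed Fock module and invariants.** Let $\langle\alpha u^i,\beta u^j\rangle_{\rm hres}=(-1)^i\langle\alpha,\beta\rangle_{\rm Muk}u^{i+j}$ on $L((u))$. The Weyl algebra $\mathcal W$ is generated over $\mathbb K[[\lambda]]$ by $L((u))$ with differential $b+uB$ and graded commutation relations $[x,y]=\mathrm{Res}_{u=0}\langle x,y\rangle_{\rm hres}\,du$. The deformed Fock module is the quotient of $\mathcal W$ by the left ideal imposing, for every $\alpha=\alpha_0+\alpha_1u+\cdots\in L[[u]]$, the relation $$\alpha=\big(T_1(\alpha_0)+T_2(\alpha_1)+T_3(\alpha_0)\big)\lambda+O(\lambda^2),$$ where $T_1(\alpha_0)=\frac12\sum(u^{-1}\alpha')(u^{-1}\alpha'')$ if $\Delta(\alpha_0)=\sum\alpha'\otimes\alpha''$, $T_2(\alpha_1)=\frac1{24}\rho(G_2)(\alpha_1)$, $T_3(\alpha_0)=-\frac14\rho(G_3)(\alpha_0)$. (The $\lambda^{2g-2+m}$-terms come from moduli of genus $g$ curves with $m$ marked boundaries; the higher order terms play no role for types $(0,3)$ and $(1,1)$.) In homology the splitting identifies the module with polynomials in the classes $u^{-j}\,\widetilde{\epsilon|\epsilon^i}$ ($j\ge1$, $0\le i\le n-1$) with coefficients in $\mathbb K[[\lambda]]$. Costello's invariant $\langle[\epsilon|\epsilon^k]\rangle_{1,1}^{A_n}$ is the coefficient of $\lambda$ in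 the constant (degree $0$ polynomial) term of the class of $\widetilde{\epsilon|\epsilon^k}$ in this module.
   Formalization: The Fock relation α = T(α)λ + O(λ²) is imposed only for (b+uB)-closed α in L[[u]], with λα = O(λ²) for all α; imposed on all α it forces λ = O(λ²) for n ≥ 2, so the invariant would be undefined. The λ² terms are left arbitrary. *)

(* Defs.v *)
From HB Require Import structures.
From mathcomp Require Import all_boot all_order all_algebra.
From mathcomp Require Import finmap.
From mathcomp Require Import boolp classical_sets functions fsbigop.
From mathcomp Require Import monalg.

Set Implicit Arguments.
Unset Strict Implicit.
Unset Printing Implicit Defensive.

Import Order.TTheory GRing.Theory Num.Theory.

Local Open Scope ring_scope.

(** * The ring K[[lambda]] *)

Section PowerSeries.
Variable K : comNzRingType.

(* The coefficient of lambda^i is the value at i. *)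
Definition pser : Type := nat -> K.

HB.instance Definition _ := Choice.on pser.
HB.instance Definition _ := GRing.Zmodule.on pser.

Definition psC (c : K) : pser := fun i => if i == 0%N then c else 0.
Definition psX : pser := fun i => (i == 1%N)%:R.
Definition psmul (f g : pser) : pser :=
  fun i => \sum_(j < i.+1) f j * g (i - j)%N.

Let tr m (f : pser) : {poly K} := \poly_(j < m) f j.

Let psmulE m f g i : (i < m)%N -> psmul f g i = (tr m f * tr m g)`_i.
Proof.
move=> im; rewrite coefM; apply: eq_bigr => j _.
rewrite !coef_poly (leq_ltn_trans _ im) ?(leq_ltn_trans _ im) ?leq_subr //.
by rewrite -ltnS.
Qed.

Fact psmulA : associative psmul.
Proof.
move=> f g h; apply/funext => i.
transitivity ((tr i.+1 f * (tr i.+1 g * tr i.+1 h))`_i).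
  rewrite coefM; apply: eq_bigr => j _; rewrite -psmulE ?ltnS ?leq_subr //.
  by rewrite coef_poly ltn_ord.
rewrite mulrA coefM; apply: eq_bigr => j _; rewrite -psmulE //.
by rewrite coef_poly ltnS leq_subr.
Qed.

Fact psmulC : commutative psmul.
Proof.
by move=> f g; apply/funext => i; rewrite !(psmulE _ _ (ltnSn i)) mulrC.
Qed.

Fact psmul1 : left_id (psC 1) psmul.
Proof.
move=> f; apply/funext => i; rewrite /psmul big_ord_recl /psC /= mul1r subn0.
by rewrite big1 ?addr0 // => j _; rewrite mul0r.
Qed.

Fact psmulDl : left_distributive psmul +%R.
Proof.
move=> f g h; apply/funext => i.
rewrite /psmul [RHS]/GRing.add /= -big_split /=.
by apply: eq_bigr => j _; rewrite -mulrDl.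
Qed.

Fact psC1_neq0 : psC 1 != 0.
Proof.
by apply/eqP => /(congr1 (fun f : pser => f 0%N)) /eqP; rewrite /psC /= oner_eq0.
Qed.

HB.instance Definition _ := GRing.Zmodule_isComNzRing.Build pser
  psmulA psmulC psmul1 psmulDl psC1_neq0.

End PowerSeries.

(** * The cyclic A-infinity algebra A_n *)

(* Basis vectors of A_n are booleans, the boolean being the shifted parity:
   the unit is odd and epsilon is even. *)
Definition unitA : bool := true.
Definition epsA : bool := false.

Section Algebra.
Variables (K : fieldType) (n : nat).

(* [mu w e] is the coefficient of e in mu_k(w), k = size w.  In the shifted
   convention a strict unit satisfies mu_2(1, a) = a and
   mu_2(a, 1) = - (-1)^|a| a, where |a| is the shifted parity. *)
Definition mu (w : seq bool) (e : bool) : K :=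
  (if w == nseq n.+1 epsA then (n.+1%:R)^-1 *+ (e == unitA) else 0)
  + match w with
    | [:: a; b] =>
        if a == unitA then (e == b)%:R
        else if b == unitA then - (e == a)%:R else 0
    | _ => 0
    end.

(* In the shifted convention the odd pairing is antisymmetric. *)
Definition pairA (a b : bool) : K :=
  if (a == unitA) && (b == epsA) then 1
  else if (a == epsA) && (b == unitA) then -1 else 0.

Definition cten (w : seq bool) : K :=
  match rev w with
  | [::] => 0
  | a :: w' => \sum_(e : bool) mu (rev w') e * pairA e a
  end.

(* The inverse of the shifted pairing, with its Koszul sign, is the odd
   symmetric tensor sum_s e_s (x) e^s = 1 (x) eps + eps (x) 1. *)
Definition dualA (s : bool) : bool := ~~ s.

(** ** Koszul signs *)

(* A letter is a basis vector together with its position in the word where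
   the operation takes its arguments; that word consists of the tensors
   e_s (x) e^s of the edges, in the order of the edges, followed by the
   inputs. *)
Definition letter := (nat * bool)%type.

Fixpoint inversions (w : seq letter) : nat :=
  if w is x :: w' then
    (count (fun y : letter => (y.1 < x.1)%N && (x.2 && y.2)) w'
     + inversions w')%N
  else 0%N.

Definition label (m : nat) (w : seq bool) : seq letter :=
  zip (iota m (size w)) w.

(* The value of the product of the (even) tensors c at the vertices [vs], with
   the Koszul sign of the permutation bringing the letters in the order of
   [vs] followed by the outputs [out]. *)
Definition contract (vs : seq (seq letter)) (out : seq letter) : K :=
  (-1) ^+ inversions (flatten vs ++ out)
  * \prod_(v <- vs) cten [seq x.2 | x <- v].

(* The letters w_i, i <= ... < j. *)
Definition slice T (w : seq T) (i j : nat) : seq T := take (j - i) (drop i w).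

(** ** Chains *)

(* The cell (a, k) is the word a | eps^k; in the reduced complex the slots
   after the bar contain only eps. *)
Definition cell := (bool * nat)%type.
Definition chain := {malg K[cell]}.

Definition word (x : cell) : seq bool := x.1 :: nseq x.2 epsA.
Definition cellC (x : cell) : chain := << x >>.

Definition linext (V : lmodType K) (f : cell -> V) (x : chain) : V :=
  \sum_(c <- msupp x) x@_c *: f c.

Definition b_cell (x : cell) : chain :=
  if (x.1 == epsA) && (n <= x.2)%N then cellC (unitA, x.2 - n)%N else 0.
Definition B_cell (x : cell) : chain :=
  if x.1 == epsA then (x.2.+1)%:R *: cellC (unitA, x.2.+1) else 0.

Definition hochb : chain -> chain := linext b_cell.
Definition connB : chain -> chain := linext B_cell.

Definition parity_cell (x : cell) : chain := (-1) ^+ (x.1 : nat) *: cellC x.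
Definition parityC : chain -> chain := linext parity_cell.

(** ** Mukai pairing, coproduct and ribbon graphs *)

Definition mukai_word (a b : seq bool) : K :=
  \sum_(q < size a) \sum_(p < q.+1) \sum_(q' < size b) \sum_(p' < q'.+1)
  \sum_(s : bool) \sum_(t : bool)
    let es := (0%N, s) in let es' := (1%N, dualA s) in
    let et := (2%N, t) in let et' := (3%N, dualA t) in
    let A := label 4 a in
    let B := label (4 + size a) b in
    contract
      [:: drop q.+1 A ++ take p.+1 A ++ es :: slice B p'.+1 q'.+1 ++ [:: et];
          drop q'.+1 B ++ take p'.+1 B ++ es' :: slice A p.+1 q.+1 ++ [:: et']]
      [::].

Definition mukai (x y : chain) : K :=
  \sum_(c <- msupp x) \sum_(d <- msupp y)
    x@_c * y@_d * mukai_word (word c) (word d).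

(* The cell (x, y) is the tensor x (x) y. *)
Definition chain2 := {malg K[(cell * cell)%type]}.

Definition coproduct_cell (x : cell) : chain2 :=
  let a := word x in
  \sum_(l < size a) \sum_(t < l.+1) \sum_(s < t.+1) \sum_(r < s.+1)
  \sum_(p : bool) \sum_(q : bool)
    let fp := (0%N, p) in let fp' := (1%N, dualA p) in
    let fq := (2%N, q) in let fq' := (3%N, dualA q) in
    let A := label 4 a in
    contract
      [:: drop l.+1 A ++ take r.+1 A ++ fp :: slice A s.+1 t.+1 ++ [:: fq]]
      (fp' :: slice A r.+1 s.+1 ++ fq' :: slice A t.+1 l.+1)
    *: << ((dualA p, s - r)%N, (dualA q, l - t)%N) >>.

Definition coproduct (x : chain) : chain2 :=
  \sum_(c <- msupp x) x@_c *: coproduct_cell c.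

End Algebra.

(* Half-edges are natural numbers; a vertex is the cyclically ordered list of
   its half-edges.  The orientation is the order of the list of edges. *)
Record ribbon := Ribbon {
  rvertices : seq (seq nat);
  redges : seq (nat * nat);
  rleg : nat
}.

Section RibbonGraph.
Variable G : ribbon.

Definition redge_of (h : nat) : nat :=
  find (fun e => (h == e.1) || (h == e.2)) (redges G).
Definition ropp (h : nat) : nat :=
  let e := nth (0, 0)%N (redges G) (redge_of h) in
  if h == e.1 then e.2 else e.1.
Definition rnext (h : nat) : nat :=
  next (nth [::] (rvertices G) (find (fun v => h \in v) (rvertices G))) h.

(* The corner between h and [rnext h] is denoted by h; the face is the list of
   the corners met from the leg on. *)
Definition rface : seq nat :=
  traject (fun h => ropp (rnext h)) (rleg G) (size (flatten (rvertices G))).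

Definition rletter (col : seq bool) (a0 : bool) (h : nat) : letter :=
  let e := redge_of h in
  let s := nth epsA col e in
  if h == rleg G then ((size (redges G)).*2, a0)
  else if h == (nth (0, 0)%N (redges G) e).1 then (e.*2, s)
  else (e.*2.+1, dualA s).

Variables (K : fieldType) (n : nat).

(* [col] lists the indices s of the basis vectors e_s at the edges, and [sh]
   the numbers of inputs placed in the successive corners of the face. *)
Definition rho_cell (x : cell) : K :=
  let a := label (size (redges G)).*2 (word x) in
  \sum_(col : (size (redges G)).-tuple bool)
  \sum_(sh : (size rface).-tuple 'I_(x.2.+1)
       | sumn [seq val i | i <- sh] == x.2)
    let blocks := reshape [seq val i | i <- sh] (behead a) in
    contract K n
      [seq flatten [seq rletter col x.1 h :: nth [::] blocks (index h rface)
                   | h <- v]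
      | v <- rvertices G]
      [::].

Definition rho (x : chain K) : K :=
  \sum_(c <- msupp x) x@_c * rho_cell c.

End RibbonGraph.

(* Leg 0, x = {1, 7}, y = {3, 8}, z = {2, 5}, w = {4, 6}.  The orientation
   y x z w is the one for which rho(G2) and the composite of the coproduct and
   the Mukai pairing (a gluing of two trivalent graphs) take the same value,
   n, on eps|eps^(n-1). *)
Definition G2 : ribbon :=
  Ribbon [:: [:: 0; 1; 2]; [:: 3; 4; 5]; [:: 6; 7; 8]]%N
         [:: (3, 8); (1, 7); (2, 5); (4, 6)]%N 0.

(* Leg 0, x = {1, 3}, w = {2, 4}.  The orientation w x is the one for which
   the relation below is compatible with b + uB, i.e.
   1/2 <B a', a''> = 1/24 rho(G2)(B a) - 1/4 rho(G3)(b a)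
   where a' (x) a'' is the coproduct of a. *)
Definition G3 : ribbon :=
  Ribbon [:: [:: 0; 1; 2; 3; 4]]%N [:: (2, 4); (1, 3)]%N 0.

(** * Laurent series of chains *)

Section Laurent.
Variable K : fieldType.

Definition bounded_below (f : int -> chain K) : bool :=
  `[< exists N : int, forall i, i < N -> f i = 0 >].

(* The coefficient of u^i is the value at i. *)
Record laurent := Laurent {
  lcoef :> int -> chain K;
  _ : bounded_below lcoef
}.

HB.instance Definition _ := [isSub for lcoef].
HB.instance Definition _ := [Choice of laurent by <:].

Fact bounded_below_submod : submod_closed bounded_below.
Proof.
split; first by apply/asboolP; exists 0.
move=> a f g /asboolP[N fN] /asboolP[M gM]; apply/asboolP.
exists (Num.min N M) => i; rewrite lt_min => /andP[iN iM].
by rewrite [LHS]/GRing.add /= [X in X + _]/GRing.scale /= fN // gM // scaler0 addr0.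
Qed.

HB.instance Definition _ :=
  GRing.isSubmodClosed.Build K (int -> chain K) bounded_below
    bounded_below_submod.
HB.instance Definition _ := [SubChoice_isSubLmodule of laurent by <:].

Fact lmono_subproof (j : int) (x : chain K) :
  bounded_below (fun i => if i == j then x else 0).
Proof. by apply/asboolP; exists j => i ij; rewrite lt_eqF. Qed.

Definition lmono (j : int) (x : chain K) : laurent :=
  Laurent (lmono_subproof j x).

Fact lshift_subproof (j : int) (x : laurent) :
  bounded_below (fun i => x (i - j)).
Proof.
case: x => f /= /asboolP[N fN]; apply/asboolP.
by exists (N + j) => i iN; apply: fN; rewrite ltrBlDr.
Qed.

(* Multiplication by u^j. *)
Definition lshift (j : int) (x : laurent) : laurent :=
  Laurent (lshift_subproof j x).

Fact linext0 (V : lmodType K) (f : cell -> V) : linext f 0 = 0.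
Proof. by rewrite /linext msupp0 big_nil. Qed.

Fact lparity_subproof (x : laurent) :
  bounded_below (fun i => parityC (x i)).
Proof.
case: x => f /= /asboolP[N fN]; apply/asboolP.
by exists N => i iN; rewrite fN // /parityC linext0.
Qed.

Definition lparity (x : laurent) : laurent := Laurent (lparity_subproof x).

Variable n : nat.

Fact ldiff_subproof (x : laurent) :
  bounded_below (fun i => hochb n (x i) + connB (x (i - 1))).
Proof.
case: x => f /= /asboolP[N fN]; apply/asboolP; exists N => i iN.
rewrite (fN i iN) fN ?(lt_trans _ iN) ?ltrBlDr ?ltrDl //.
by rewrite /hochb /connB !linext0 addr0.
Qed.

(* The differential b + uB. *)
Definition ldiff (x : laurent) : laurent := Laurent (ldiff_subproof x).

Definition homogeneous (p : bool) (x : laurent) : Prop :=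
  forall (i : int) (c : cell), c.1 != p -> (x i)@_c = 0.

Definition in_Lu (x : laurent) : Prop := forall i : int, i < 0 -> x i = 0.

(* Res <x, y>_hres du; the sum has finitely many nonzero terms. *)
Definition res_hres (x y : laurent) : K :=
  \sum_(i \in [set: int]) (-1) ^ i * mukai n (x i) (y (- 1 - i)).

(** ** The splitting *)

Definition split_coef (k l : nat) : K :=
  \prod_(j < l) (k + 1 + j * n.+1)%:R.

Fact split_lift_subproof (k : nat) :
  bounded_below (fun i : int =>
    if i is Posz l then
      (-1) ^+ l * split_coef k l *: cellC K (epsA, (k + n * l + l)%N)
    else 0).
Proof. by apply/asboolP; exists 0; case. Qed.

Definition split_lift (k : nat) : laurent := Laurent (split_lift_subproof k).

End Laurent.

(** * The deformed Fock module modulo lambda^2 *)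

Section Fock.
Variables (K : fieldType) (n : nat).

(* The free K[[lambda]]-algebra on the set L((u)). *)
Definition freeW := {malg (pser K)[{fmonom (laurent K)}]}.

Definition gen (x : laurent K) : freeW := << fmu x >>.
Definition scalW (r : pser K) : freeW := r%:MP.
Definition lam : freeW := scalW (psX K).

(* The defining relations of the Weyl algebra. *)
Inductive weyl_rel : freeW -> Prop :=
| weyl_add x y : weyl_rel (gen (x + y) - gen x - gen y)
| weyl_scale (a : K) x : weyl_rel (gen (a *: x) - scalW (psC a) * gen x)
| weyl_comm (p q : bool) x y : homogeneous p x -> homogeneous q y ->
    weyl_rel (gen x * gen y - (-1) ^+ (p && q) * (gen y * gen x)
              - scalW (psC (res_hres n x y))).

(* The odd derivation extending b + uB; [lparity] gives its Koszul signs, also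
   on inhomogeneous generators. *)
Definition diff_word (w : seq (laurent K)) : freeW :=
  \sum_(i < size w)
    (\prod_(x <- take i w) gen (lparity x)) * gen (ldiff n (nth 0 w i))
    * \prod_(x <- drop i.+1 w) gen x.

Definition diffW (z : freeW) : freeW :=
  \sum_(w <- msupp z) scalW z@_w * diff_word w.

Definition T1 (x : chain K) : freeW :=
  let um1 c := gen (lmono (-1) (cellC K c)) in
  scalW (psC 2^-1) *
  \sum_(c <- msupp (coproduct n x))
    scalW (psC (coproduct n x)@_c) * (um1 c.1 * um1 c.2).

Definition T2 (x : chain K) : freeW := scalW (psC (24%:R^-1 * rho G2 n x)).
Definition T3 (x : chain K) : freeW := scalW (psC (- (4%:R^-1) * rho G3 n x)).

Definition Trel (x : laurent K) : freeW := T1 (x 0) + T2 (x 1) + T3 (x 0).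

(* The elements of [freeW] that vanish in the deformed Fock module: a left
   ideal, which contains the two-sided ideal of the Weyl relations.  The
   unspecified terms O(lambda^2) of the relations are arbitrary.

   On chains that are not (b + uB)-closed the coproduct is symmetric under the
   exchange of inputs and outputs (by the Mukai pairing) only up to homotopy.
   The relation alpha = T(alpha) lambda + O(lambda^2) is hence imposed on closed
   alpha, and its consequence lambda alpha = O(lambda^2) on all alpha.  Imposed
   on alpha = eps|eps^0 and alpha = eps|eps^n for n >= 2 it would, as these
   commute, give 0 = lambda u^-1 (eps|eps) + O(lambda^2), and the commutator
   with eps|eps^(n-2) would then give lambda = O(lambda^2). *)
Inductive fock_null : freeW -> Prop :=
| fock_zero : fock_null 0
| fock_add z z' : fock_null z -> fock_null z' -> fock_null (z + z')
| fock_weyl z r z' : weyl_rel r -> fock_null (z * r * z')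
| fock_closed z alpha r : in_Lu alpha -> ldiff n alpha = 0 ->
    fock_null (z * (gen alpha - lam * Trel alpha + lam ^+ 2 * r))
| fock_order0 z alpha r : in_Lu alpha ->
    fock_null (z * (lam * gen alpha + lam ^+ 2 * r)).

(* Equality of the classes in the homology of the deformed Fock module. *)
Definition fock_homologous (z z' : freeW) : Prop :=
  exists t, fock_null (z - z' - diffW t).

(* Polynomials over K[[lambda]] in the classes u^-j (lift of eps|eps^i); the
   variable (j, i) stands for u^-(j+1) (lift of eps|eps^i). *)
Definition fockVar := (nat * 'I_n)%type.
Definition fockPoly := {malg (pser K)[{cmonom fockVar}]}.

Definition fock_var (v : fockVar) : laurent K :=
  lshift (- (v.1.+1)%:Z) (split_lift K n v.2).

(* The generators [gen (fock_var v)] commute in the Weyl algebra, so the order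
   of the factors is irrelevant. *)
Definition fock_eval (P : fockPoly) : freeW :=
  \sum_(m <- msupp P)
    scalW P@_m * \prod_(v <- finsupp (cmonom_val m)) gen (fock_var v) ^+ m v.

(* v is the value of Costello's invariant < [eps|eps^k] >_{1,1}: the class of
   the lift of eps|eps^k is a polynomial P, and v is the coefficient of lambda
   in the constant term of P. *)
Definition is_costello11 (k : nat) (v : K) : Prop :=
  exists P : fockPoly,
    fock_homologous (gen (split_lift K n k)) (fock_eval P)
    /\ v = (P@_(mone : {cmonom fockVar}) : pser K) 1%N.

End Fock.

(* Main.v *)
Require Import Defs.
From mathcomp Require Import all_boot all_order all_algebra finmap monalg.
From mathcomp Require Import boolp classical_sets functions fsbigop.
From mathcomp Require Import zify ring.

Set Implicit Arguments.
Unset Strict Implicit.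
Unset Printing Implicit Defensive.

Import Order.TTheory GRing.Theory Num.Theory.

Local Open Scope ring_scope.

(** Let H be the span of the cells eps|eps^k with k < n, and R the span of the
    cells 1|eps^k and of the eps|eps^k with k >= n.

    The cyclic tensors of A_n are nonzero only on words of n+2 letters eps, and
    on words of three letters of which two are units ([cten_supp]).  Every edge
    of a graph brings exactly one unit to its ends, so that the operations are
    evaluated by counting units and letters at the vertices:
    - R is the radical of the Mukai pairing, and eps|eps^i pairs with eps|eps^j
      to 1 if i + j = n - 1 and to 0 otherwise ([mukaiE]);
    - for k < n the coproduct of eps|eps^k is the sum of the
      eps|eps^i (x) eps|eps^j with i + j = k, plus a multiple of 1 (x) 1
      ([coproduct_cell_eps]);
    - rho(G3) = 0, and rho(G2) is nonzero at most on eps|eps^(n-1)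
      ([rho_cell_G3], [rho_cell_G2]).

    The lift of eps|eps^k has the term of order u in eps|eps^(k+n+1), on which
    rho(G2) vanishes.  Its relation in the Fock module therefore reads
    lift = lambda/2 sum_(i+j=k) (u^-1 eps|eps^i)(u^-1 eps|eps^j), the square of
    the odd generator u^-1 1 being zero.  Replacing eps|eps^i by its lift only
    adds elements of L[[u]], which commute with the other factor and vanish to
    first order.  The class is thus a quadratic polynomial in the classes of the
    splitting, with constant term 0 ([costello11_0]).

    It remains to see that the value is unique, that is, that the relations do
    not collapse the module.  The differential b + uB maps L((u)) to R((u))
    ([epsc_ldiff]).  Modulo R((u)) the Weyl algebra is the one of H((u)), with
    zero differential.  It acts on the polynomials in the variables
    u^-j eps|eps^i: polar parts act by multiplication, and x in H[[u]] acts by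
    a derivative plus lambda times the multiplication by a potential T(x)
    ([fock_op]).  This is a representation ([fock_op_comm]) because the
    derivative of T(x) in the direction y is symmetric in x and y
    ([D_potential_sym]).  On the vacuum 1 all relations of the Fock module hold
    modulo lambda^2 ([rep_null]), boundaries act by zero ([rep_diff]), and a
    polynomial P in the variables gives back P.  So if P represents the class
    of the lift, P agrees modulo lambda^2 with lambda times a quadratic form
    ([costello11_eq0]). *)

(** * Sums over the support of an element of a monoid algebra *)

Lemma mcoeff_sum (T : choiceType) (G : zmodType) I r (P : pred I)
  (F : I -> {malg G[T]}) k :
  (\sum_(i <- r | P i) F i)@_k = \sum_(i <- r | P i) (F i)@_k.
Proof. exact: (raddf_sum (mcoeff k)). Qed.

Section AdditiveExtension.
Variables (T : choiceType) (A W : zmodType) (h : T -> A -> W).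
Hypothesis h0 : forall t, h t 0 = 0.
Hypothesis hD : forall t a b, h t (a + b) = h t a + h t b.

Definition addext (x : {malg A[T]}) : W := \sum_(t <- msupp x) h t x@_t.

Lemma addextEw (d : {fset T}) (x : {malg A[T]}) : (msupp x `<=` d)%fset ->
  addext x = \sum_(t <- d) h t x@_t.
Proof.
by move=> xd; apply: big_fset_incl => // t _ /mcoeff_outdom ->.
Qed.

Lemma addextD x y : addext (x + y) = addext x + addext y.
Proof.
set d := (msupp x `|` msupp y)%fset.
rewrite (@addextEw d) ?msuppD_le // (@addextEw d x) ?fsubsetUl //.
rewrite (@addextEw d y) ?fsubsetUr // -big_split /=.
by apply: eq_bigr => t _; rewrite mcoeffD hD.
Qed.

Lemma addextU a t : addext << a *g t >> = h t a.
Proof.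
rewrite (@addextEw [fset t]%fset) ?msuppU_le // big_seq_fset1.
by rewrite mcoeffUU.
Qed.

Lemma addext0 : addext 0 = 0.
Proof. by rewrite /addext msupp0 big_nil. Qed.

Lemma addext_sum I r (P : pred I) (F : I -> {malg A[T]}) :
  addext (\sum_(i <- r | P i) F i) = \sum_(i <- r | P i) addext (F i).
Proof. by apply: (big_morph _ addextD addext0). Qed.

End AdditiveExtension.

(** * The cyclic tensors of A_n and the Mukai pairing *)

Section Cten.
Variables (K : fieldType) (n : nat).

Notation units := (count_mem unitA).

Lemma cten_rcons w a :
  cten K n (rcons w a) =
  if a == unitA then - mu K n w epsA else mu K n w unitA.
Proof.
rewrite /cten rev_rcons revK big_bool /pairA.
by case: a; rewrite /= ?mulrN ?mulr1 ?mulr0 ?addr0 ?add0r.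
Qed.

Lemma cten_eps m : cten K n (nseq m epsA) =
  if m == n.+2 then (n.+1%:R)^-1 else 0.
Proof.
case: m => [|m]; first by rewrite /cten.
have -> : nseq m.+1 epsA = rcons (nseq m epsA) epsA by elim: m => //= m ->.
rewrite cten_rcons /mu /= eqSS.
have -> : (nseq m epsA == nseq n.+1 epsA) = (m == n.+1).
  by apply/eqP/eqP => [/(congr1 size)|->] //; rewrite !size_nseq.
by case: m => [|[|[|m]]]; rewrite /= ?addr0.
Qed.

Lemma cten_uue : cten K n [:: unitA; unitA; epsA] = 1.
Proof. by rewrite (cten_rcons [:: _; _]) /mu /= add0r. Qed.

Lemma cten_ueu : cten K n [:: unitA; epsA; unitA] = -1.
Proof. by rewrite (cten_rcons [:: _; _]) /mu /= add0r. Qed.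

Lemma cten_euu : cten K n [:: epsA; unitA; unitA] = 1.
Proof.
by rewrite (cten_rcons [:: _; _]) /mu; case: n => [|m]; rewrite /= add0r opprK.
Qed.

Lemma nseq_eps w : units w = 0%N -> w = nseq (size w) epsA.
Proof. by elim: w => // -[] w //= IH /IH <-. Qed.

(** Since mu_(n+1)(eps, ..., eps) is a multiple of the unit and the pairing
    only pairs the unit with eps, the cyclic tensor is nonzero on exactly two
    kinds of words. Counting units and letters with this lemma decides which
    graphs contribute. *)
Lemma cten_supp w : cten K n w != 0 ->
  (units w = 0 /\ size w = n.+2) \/ (units w = 2 /\ size w = 3)%N.
Proof.
have [/nseq_eps wE|units_gt0] := eqVneq (units w) 0%N.
  rewrite wE cten_eps; case: ifP => [/eqP sz _|]; last by rewrite eqxx.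
  by left; rewrite size_nseq sz; split=> //; apply/count_memPn/nseqP => -[].
case/lastP: w units_gt0 => [|w a]; first by [].
rewrite cten_rcons /mu -cats1 count_cat size_cat addn1.
have [->|_] := eqVneq w (nseq n.+1 epsA).
  rewrite count_nseq mul0n add0n size_nseq.
  by case: a => //= _; case: n => [|[|m]]; rewrite ?add0r ?oppr0 ?eqxx.
case: w => [|[] [|[] [|c w]]]; case: a => //= _;
  rewrite ?add0r ?oppr0 ?eqxx //; by right.
Qed.

Lemma cten_odd_units w : odd (units w) -> cten K n w = 0.
Proof.
move=> oddw; apply/eqP; apply: contraTT oddw => /cten_supp.
by case=> -[-> _].
Qed.

(** Only the odd letters, that is the units, carry Koszul signs. *)
Lemma inversions_filter w :
  inversions w = inversions [seq x <- w | x.2].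
Proof.
elim: w => //= x w IH; rewrite IH; case: ifP => [x2 /=|x2].
  rewrite count_filter; congr (_ + _)%N; apply: eq_count => y /=.
  by rewrite x2 -andbA andbb.
by rewrite (eq_count (a2 := pred0)) ?count_pred0 // => y; rewrite /= andbF.
Qed.

Lemma unzip2_label m w : [seq x.2 | x <- label m w] = w.
Proof. by rewrite -/(unzip2 _) unzip2_zip // size_iota. Qed.

Lemma map_slice (S T : Type) (f : S -> T) w i j :
  map f (slice w i j) = slice (map f w) i j.
Proof. by rewrite /slice map_take map_drop. Qed.

Lemma filter_label_eps m k : [seq x <- label m (nseq k epsA) | x.2] = [::].
Proof.
by rewrite /label size_nseq; elim: k m => //= k IH m; rewrite IH.
Qed.

Lemma filter_sub_nil (T : eqType) (a : pred T) (s t : seq T) :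
  {subset s <= t} -> filter a t = [::] -> filter a s = [::].
Proof.
move=> st ta; apply/eqP; rewrite -[_ == _]negbK -has_filter.
apply/hasPn => x /st xt; apply/negP => ax.
by have := mem_filter a x t; rewrite ta ax xt.
Qed.

Lemma drop_filter_nil (a : pred letter) s i :
  filter a s = [::] -> filter a (drop i s) = [::].
Proof. by apply: filter_sub_nil => x /mem_drop. Qed.

Lemma take_filter_nil (a : pred letter) s i :
  filter a s = [::] -> filter a (take i s) = [::].
Proof. by apply: filter_sub_nil => x /mem_take. Qed.

Lemma slice_filter_nil (a : pred letter) s i j :
  filter a s = [::] -> filter a (slice s i j) = [::].
Proof. by move=> s0; rewrite take_filter_nil // drop_filter_nil. Qed.

Lemma size_word x : size (word x) = x.2.+1.
Proof. by rewrite /= size_nseq. Qed.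

Lemma cten_all_eps a b c :
  cten K n (nseq a epsA ++ epsA :: nseq b epsA ++
            epsA :: nseq c epsA ++ [:: epsA])
  = if ((a + b + c).+1 == n)%N then (n.+1%:R)^-1 else 0.
Proof.
have -> : epsA :: nseq c epsA ++ [:: epsA] = nseq c.+2 epsA.
  by rewrite -[[:: _]]/(nseq 1 epsA) -nseqD addn1.
rewrite -nseqD -[_ :: nseq _ _]/(nseq _.+1 epsA) -nseqD cten_eps.
by congr (if _ then _ else _); lia.
Qed.

Lemma cten_two_units a b c :
  cten K n (nseq a epsA ++ epsA :: nseq b epsA ++
            unitA :: nseq c epsA ++ [:: unitA])
  = ((a == 0) && (b == 0) && (c == 0))%:R%N.
Proof.
set w := (X in cten _ _ X).
have [w0|/cten_supp] := eqVneq (cten K n w) 0; last first.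
  rewrite !(count_cat, size_cat) /= !(count_cat, size_cat) /=.
  rewrite !(count_cat, size_cat) /= !count_nseq !size_nseq !mul0n.
  move=> -[[] //|[_ sz]].
  have [a0 b0 c0] : [/\ a = 0, b = 0 & c = 0]%N by split; lia.
  by rewrite /w a0 b0 c0 cten_euu.
rewrite w0; case: eqP => //= a0; case: eqP => //= b0; case: eqP => //= c0.
by move: w0; rewrite /w a0 b0 c0 cten_euu => /eqP; rewrite oner_eq0.
Qed.

(** A vertex on which an edge of each colour ends carries one unit. *)
Lemma cten_mixed a b c u :
  cten K n (nseq a epsA ++ epsA :: nseq b epsA ++
            u :: nseq c epsA ++ [:: ~~ u]) = 0.
Proof.
rewrite cten_odd_units // !(count_cat, count_nseq) /= !(count_cat, count_nseq) /=.
by rewrite !(count_cat, count_nseq) /= !mul0n; case: u.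
Qed.

Definition mukai_term (a b : seq bool) (q p q' p' : nat) (s t : bool) : K :=
  let es := (0%N, s) in let es' := (1%N, dualA s) in
  let et := (2%N, t) in let et' := (3%N, dualA t) in
  let A := label 4 a in
  let B := label (4 + size a) b in
  contract K n
    [:: drop q.+1 A ++ take p.+1 A ++ es :: slice B p'.+1 q'.+1 ++ [:: et];
        drop q'.+1 B ++ take p'.+1 B ++ es' :: slice A p.+1 q.+1 ++ [:: et']]
    [::].

Lemma mukai_wordE a b : mukai_word K n a b =
  \sum_(q < size a) \sum_(p < q.+1) \sum_(q' < size b) \sum_(p' < q'.+1)
  \sum_(s : bool) \sum_(t : bool) mukai_term a b q p q' p' s t.
Proof. by []. Qed.

(** If both edges bring their units to the first vertex, this vertex is a0 1
    1 with nothing else, and all the other letters, n+2 in number, sit at the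
    second one; symmetrically with the vertices exchanged. If the edges
    differ in colour each vertex carries a single unit. *)
Lemma mukai_term_eps i j q p q' p' s t :
  (q < i.+1)%N -> (p < q.+1)%N -> (q' < j.+1)%N -> (p' < q'.+1)%N ->
  mukai_term (word (epsA, i)) (word (epsA, j)) q p q' p' s t =
  if (i + j).+1 == n then
    (if s && t then
       ((q == i) && (p == 0%N) && (p' == q'))%:R
     else if ~~ s && ~~ t then
       ((q' == j) && (p' == 0%N) && (p == q))%:R
     else 0) * (n.+1%:R)^-1
  else 0.
Proof.
move=> lq lp lq' lp'; rewrite /mukai_term /contract inversions_filter cats0.
set A := label 4 _; set B := label _ _.
have fA : [seq x <- A | x.2] = [::] by exact: filter_label_eps.
have fB : [seq x <- B | x.2] = [::] by exact: filter_label_eps.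
have mA : [seq x.2 | x <- A] = nseq i.+1 epsA by exact: unzip2_label.
have mB : [seq x.2 | x <- B] = nseq j.+1 epsA by exact: unzip2_label.
clearbody A B.
rewrite !big_cons big_nil mulr1 /= cats0.
rewrite !(map_cat, map_cons, map_drop, map_take, map_slice) /=.
rewrite !mA !mB.
rewrite !drop_nseq !take_nseq; try lia.
rewrite !filter_cat /= !filter_cat.
rewrite !(drop_filter_nil _ fA) !(drop_filter_nil _ fB).
rewrite !(take_filter_nil _ fA) !(take_filter_nil _ fB).
rewrite !(slice_filter_nil _ _ fA) !(slice_filter_nil _ _ fB) !subSS.
case: s t => [] []; rewrite /dualA.
- rewrite (cten_two_units _ _ _) (cten_all_eps _ _ _) /= expr0 mul1r.
  have -> : (i - q == 0)%N && (p == 0)%N && (q' - p' == 0)%N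
            = (q == i) && (p == 0)%N && (p' == q') by lia.
  case: andP => [[/andP[/eqP -> /eqP ->] /eqP ->]|_]; last first.
    by rewrite !mul0r if_same.
  by rewrite !mul1r; congr (if _ then _ else _); lia.
- by rewrite (cten_mixed _ _ _ true) mul0r mulr0 mul0r if_same.
- by rewrite (cten_mixed _ _ _ false) mul0r mulr0 mul0r if_same.
- rewrite (cten_two_units _ _ _) (cten_all_eps _ _ _) /= expr0 mul1r mulrC.
  have -> : (j - q' == 0)%N && (p' == 0)%N && (q - p == 0)%N
            = (q' == j) && (p' == 0)%N && (p == q) by lia.
  case: andP => [[/andP[/eqP -> /eqP ->] /eqP ->]|_]; last first.
    by rewrite !mul0r if_same.
  by rewrite !mul1r; congr (if _ then _ else _); lia.
Qed.

Lemma sum_delta m k :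
  \sum_(p < m) (p == k :> nat)%:R = (k < m)%:R :> K.
Proof.
have [km|mk] := ltnP k m; last first.
  by rewrite big1 // => p _; rewrite ltn_eqF // (leq_trans (ltn_ord p)).
rewrite (bigD1 (Ordinal km)) //= eqxx big1 ?addr0 // => p pk.
by rewrite (_ : (_ == _) = false) //; apply: contraNF pk.
Qed.

(** The only free choice is where b0, respectively a0, is cut off from the
    other letters of its cyclic word, which gives j+1 and i+1 terms, all
    equal to 1/(n+1). *)
Lemma mukai_eps i j :
  mukai_word K n (word (epsA, i)) (word (epsA, j)) =
  if (i + j).+1 == n then (i + j).+2%:R / n.+1%:R else 0.
Proof.
rewrite mukai_wordE !size_word /=; case: ifP => [ijn|ijn]; last first.
  rewrite big1 // => q _; rewrite big1 // => p _; rewrite big1 // => q' _.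
  rewrite big1 // => p' _; rewrite big1 // => s _; rewrite big1 // => t _.
  by rewrite mukai_term_eps // ijn.
transitivity (\sum_(q < i.+1) \sum_(p < q.+1) \sum_(q' < j.+1) \sum_(p' < q'.+1)
   ((q == i :> nat)%:R * (p == 0 :> nat)%N%:R * (p' == q' :> nat)%:R +
    (q' == j :> nat)%:R * (p' == 0 :> nat)%N%:R * (p == q :> nat)%:R)
   / n.+1%:R : K).
  apply: eq_bigr => q _; apply: eq_bigr => p _; apply: eq_bigr => q' _.
  apply: eq_bigr => p' _; rewrite !big_bool !mukai_term_eps // ijn /=.
  by rewrite !mul0r addr0 add0r -mulrDl -!natrM !mulnb.
transitivity (\sum_(q < i.+1) \sum_(p < q.+1) \sum_(q' < j.+1)
   ((q == i :> nat)%:R * (p == 0 :> nat)%N%:R +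
    (q' == j :> nat)%:R * (p == q :> nat)%:R) / n.+1%:R : K).
  do 3![apply: eq_bigr => ? _]; rewrite -mulr_suml; congr (_ / _).
  rewrite big_split /= -mulr_sumr -mulr_suml -mulr_sumr !sum_delta.
  by rewrite ltnSn !mulr1.
transitivity (\sum_(q < i.+1) \sum_(p < q.+1)
   ((q == i :> nat)%:R * (p == 0 :> nat)%N%:R *+ j.+1 +
    (p == q :> nat)%:R) / n.+1%:R : K).
  do 2![apply: eq_bigr => ? _]; rewrite -mulr_suml; congr (_ / _).
  by rewrite big_split /= sumr_const card_ord -mulr_suml sum_delta ltnSn mul1r.
transitivity (\sum_(q < i.+1) ((q == i :> nat)%:R *+ j.+1 + 1) / n.+1%:R : K).
  apply: eq_bigr => ? _; rewrite -mulr_suml; congr (_ / _).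
  by rewrite big_split /= sumrMnl -mulr_sumr !sum_delta ltnSn ltn0Sn mulr1.
rewrite -mulr_suml big_split /= sumrMnl sum_delta ltnSn sumr_const card_ord.
by rewrite -natrD; congr (_%:R / _); lia.
Qed.

Lemma mukai_term_words u i u' j q p q' p' s t :
  (q < i.+1)%N -> (p < q.+1)%N -> (q' < j.+1)%N -> (p' < q'.+1)%N ->
  exists N, mukai_term (word (u, i)) (word (u', j)) q p q' p' s t =
  (-1) ^+ N *
   (cten K n (nseq (i - q) epsA ++ u :: nseq p epsA ++
              s :: nseq (q' - p') epsA ++ [:: t]) *
    cten K n (nseq (j - q') epsA ++ u' :: nseq p' epsA ++
              ~~ s :: nseq (q - p) epsA ++ [:: ~~ t])).
Proof.
move=> lq lp lq' lp'; rewrite /mukai_term /contract.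
set N := inversions _; exists N; congr (_ * _).
set A := label 4 _; set B := label _ _.
have mA : [seq x.2 | x <- A] = u :: nseq i epsA by exact: unzip2_label.
have mB : [seq x.2 | x <- B] = u' :: nseq j epsA by exact: unzip2_label.
clearbody A B; rewrite !big_cons big_nil mulr1.
rewrite !(map_cat, map_cons, map_drop, map_take, map_slice) /= !mA !mB /=.
by rewrite !drop_nseq !take_nseq //; lia.
Qed.

(** The two edges contribute two units in total, so with one more among the
    inputs some vertex carries an odd number of them. *)
Lemma mukai_mixed u i u' j : u != u' ->
  mukai_word K n (word (u, i)) (word (u', j)) = 0.
Proof.
move=> uu'; rewrite mukai_wordE !size_word /=.
rewrite big1 // => q _; rewrite big1 // => p _; rewrite big1 // => q' _.
rewrite big1 // => p' _; rewrite big1 // => s _; rewrite big1 // => t _.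
have [||||N ->] := @mukai_term_words u i u' j q p q' p' s t; rewrite ?ltn_ord //.
set v1 := cten _ _ _; set v2 := cten _ _ _.
suff [->|->] : v1 = 0 \/ v2 = 0 by rewrite ?mul0r !mulr0.
have cnt (a b c : nat) (x y z : bool) :
    count_mem unitA (nseq a epsA ++ x :: nseq b epsA ++
                     y :: nseq c epsA ++ [:: z]) = (x + y + z)%N.
  rewrite !(count_cat, count_nseq) /= !(count_cat, count_nseq) /=.
  by rewrite !(count_cat, count_nseq) /= !mul0n; case: x y z => [] [] [].
rewrite {}/v1 {}/v2; case: u u' s t uu' => [] [] [] [] //= _;
  solve [by left; apply: cten_odd_units; rewrite cnt
        |by right; apply: cten_odd_units; rewrite cnt].
Qed.

(** Both vertices need exactly one further unit and no other letter, so i = j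
    = 0 and two terms remain, which cancel. *)
Lemma mukai_unit i j :
  mukai_word K n (word (unitA, i)) (word (unitA, j)) = 0.
Proof.
rewrite mukai_wordE !size_word /=.
have [/andP[/eqP -> /eqP ->]|ij] := boolP ((i == 0%N) && (j == 0%N)).
  rewrite 4!big_ord1 !big_bool /mukai_term /contract /= !big_cons !big_nil /=.
  rewrite !cten_uue !cten_ueu.
  rewrite ![cten _ _ [:: _; _; _]]cten_odd_units // !(mul0r, mulr0) add0r addr0.
  (* The two surviving colourings of the edges have opposite Koszul signs. *)
  rewrite [X in (-1) ^+ X * _ + _](_ : _ = 3%N) //.
  rewrite [X in _ + (-1) ^+ X * _](_ : _ = 4%N) //.
  by rewrite !exprS expr0 !mulr1 !mulN1r !opprK; ring.
rewrite big1 // => q _; rewrite big1 // => p _; rewrite big1 // => q' _.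
rewrite big1 // => p' _; rewrite big1 // => s _; rewrite big1 // => t _.
have [||||N ->] := @mukai_term_words unitA i unitA j q p q' p' s t;
  rewrite ?ltn_ord //.
set v1 := cten _ _ _; set v2 := cten _ _ _.
have [|] := eqVneq v1 0; first by move=> ->; rewrite mul0r mulr0.
have [|] := eqVneq v2 0; first by move=> ->; rewrite !mulr0.
move=> /cten_supp + /cten_supp.
rewrite !(count_cat, size_cat) /= !(count_cat, size_cat) /=.
rewrite !(count_cat, size_cat) /= !(count_nseq, size_nseq) /= !mul0n.
move: ij; case: (s) (t) => [] [] /=; lia.
Qed.

End Cten.

(** * The coproduct *)

Section Coproduct.
Variables (K : fieldType) (n : nat).

Definition coproduct_term (a : seq bool) (l t s r : nat) (p q : bool) : K :=
  let fp := (0%N, p) in let fp' := (1%N, dualA p) in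
  let fq := (2%N, q) in let fq' := (3%N, dualA q) in
  let A := label 4 a in
  contract K n
    [:: drop l.+1 A ++ take r.+1 A ++ fp :: slice A s.+1 t.+1 ++ [:: fq]]
    (fp' :: slice A r.+1 s.+1 ++ fq' :: slice A t.+1 l.+1).

Lemma coproduct_cellE x : coproduct_cell K n x =
  \sum_(l < size (word x)) \sum_(t < l.+1) \sum_(s < t.+1) \sum_(r < s.+1)
  \sum_(p : bool) \sum_(q : bool)
  coproduct_term (word x) l t s r p q
    *: << ((dualA p, s - r)%N, (dualA q, l - t)%N) >>.
Proof. by []. Qed.

Lemma coproduct_term_words u k l t s r p q :
  (l < k.+1)%N -> (t < l.+1)%N -> (s < t.+1)%N -> (r < s.+1)%N ->
  exists N, coproduct_term (word (u, k)) l t s r p q =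
  (-1) ^+ N *
   cten K n (nseq (k - l) epsA ++ u :: nseq r epsA ++
              p :: nseq (t - s) epsA ++ [:: q]).
Proof.
move=> ll lt ls lr; rewrite /coproduct_term /contract.
set N := inversions _; exists N; congr (_ * _).
set A := label 4 _.
have mA : [seq x.2 | x <- A] = u :: nseq k epsA by exact: unzip2_label.
clearbody A; rewrite !big_cons big_nil mulr1.
rewrite !(map_cat, map_cons, map_drop, map_take, map_slice) /= !mA /=.
by rewrite !drop_nseq !take_nseq //; lia.
Qed.

Lemma coproduct_term_unit k l t s r :
  (l < k.+1)%N -> (t < l.+1)%N -> (s < t.+1)%N -> (r < s.+1)%N ->
  coproduct_term (word (unitA, k)) l t s r unitA unitA = 0.
Proof.
move=> ll lt ls lr.
have [||||N ->] := @coproduct_term_words unitA k l t s r unitA unitA => //.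
rewrite cten_odd_units ?mulr0 // !(count_cat, count_nseq) /=.
by rewrite !(count_cat, count_nseq) /= !(count_cat, count_nseq) /= ?mul0n.
Qed.

Lemma coproduct_term_mixed k l t s r p :
  (l < k.+1)%N -> (t < l.+1)%N -> (s < t.+1)%N -> (r < s.+1)%N ->
  coproduct_term (word (epsA, k)) l t s r p (~~ p) = 0.
Proof.
move=> ll lt ls lr.
have [||||N ->] := @coproduct_term_words epsA k l t s r p (~~ p) => //.
by rewrite cten_mixed mulr0.
Qed.

(** A vertex with n + 2 letters eps has n - 1 of them besides a0 and the two
    edges, so for k < n all of the k inputs after the bar sit there and none
    remains for the outputs. *)
Lemma coproduct_term_eps k l t s r : (k < n)%N ->
  (l < k.+1)%N -> (t < l.+1)%N -> (s < t.+1)%N -> (r < s.+1)%N ->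
  coproduct_term (word (epsA, k)) l t s r epsA epsA != 0 ->
  (s - r = 0)%N /\ (l - t = 0)%N.
Proof.
move=> kn ll lt ls lr.
have [||||N ->] := @coproduct_term_words epsA k l t s r epsA epsA => //.
rewrite cten_all_eps; case: ifP => [/eqP eqn _|]; last by rewrite mulr0 eqxx.
lia.
Qed.

Lemma coproduct_term_unit_edges k l t s r :
  (l < k.+1)%N -> (t < l.+1)%N -> (s < t.+1)%N -> (r < s.+1)%N ->
  coproduct_term (word (epsA, k)) l t s r unitA unitA =
  ((l == k) && (s == t) && (r == 0%N))%:R.
Proof.
move=> ll lt ls lr; rewrite /coproduct_term /contract inversions_filter.
set A := label 4 _.
have fA : [seq x <- A | x.2] = [::] by exact: filter_label_eps.
have mA : [seq x.2 | x <- A] = nseq k.+1 epsA by exact: unzip2_label.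
clearbody A; rewrite !big_cons big_nil mulr1.
rewrite !(map_cat, map_cons, map_drop, map_take, map_slice) /= !mA.
rewrite !drop_nseq !take_nseq; try lia.
rewrite !cats0 !filter_cat /= !filter_cat /=.
rewrite !(drop_filter_nil _ fA) !(take_filter_nil _ fA).
rewrite !(slice_filter_nil _ _ fA) !subSS (cten_two_units _ _ _ r) /=.
by rewrite expr0 mul1r; congr (_ %:R); lia.
Qed.

Lemma sum_pred1 (V : lmodType K) m k (F : nat -> V) : (k < m)%N ->
  \sum_(p < m) (p == k :> nat)%:R *: F p = F k.
Proof.
move=> km; rewrite (bigD1 (Ordinal km)) //= eqxx scale1r big1 ?addr0 // => p pk.
by rewrite (_ : (_ == _) = false) ?scale0r //; apply: contraNF pk.
Qed.

Lemma sum_bool2 (V : zmodType) (F : bool -> bool -> V) :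
  (forall p, F p (~~ p) = 0) ->
  \sum_(p : bool) \sum_(q : bool) F p q = F unitA unitA + F epsA epsA.
Proof.
by move=> F0; rewrite !big_bool; move: (F0 true) (F0 false) => /= -> ->;
  rewrite addr0 add0r.
Qed.

Lemma coproduct_sum_eps (V : lmodType K) (g : cell -> cell -> V) k :
  (k < n)%N -> exists c : K,
  \sum_(l < k.+1) \sum_(t < l.+1) \sum_(s < t.+1) \sum_(r < s.+1)
  \sum_(p : bool) \sum_(q : bool)
    coproduct_term (word (epsA, k)) l t s r p q
    *: g (dualA p, s - r)%N (dualA q, l - t)%N =
  \sum_(t < k.+1) g (epsA, t : nat) (epsA, (k - t)%N)
  + c *: g (unitA, 0%N) (unitA, 0%N).
Proof.
move=> kn; pose d l t s r := coproduct_term (word (epsA, k)) l t s r epsA epsA.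
exists (\sum_(l < k.+1) \sum_(t < l.+1) \sum_(s < t.+1) \sum_(r < s.+1)
          d l t s r).
transitivity (\sum_(l < k.+1) \sum_(t < l.+1) \sum_(s < t.+1) \sum_(r < s.+1)
  ((r == 0 :> nat)%N%:R *: ((s == t :> nat)%:R *: ((l == k :> nat)%:R *:
     g (epsA, s - r)%N (epsA, l - t)%N)) +
   d l t s r *: g (unitA, 0%N) (unitA, 0%N))).
  apply: eq_bigr => l _; apply: eq_bigr => t _; apply: eq_bigr => s _.
  apply: eq_bigr => r _; rewrite sum_bool2; last first.
    by move=> p; rewrite coproduct_term_mixed ?scale0r.
  congr (_ + _).
    rewrite coproduct_term_unit_edges // !scalerA -!natrM !mulnb.
    by rewrite [in LHS]andbC [X in _ && X]andbC andbA.
  rewrite -/(d l t s r); have [->|] := eqVneq (d l t s r) 0.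
    by rewrite !scale0r.
  by case/coproduct_term_eps => // -> ->.
under eq_bigr => l _ do under eq_bigr => t _ do under eq_bigr => s _ do
  rewrite big_split -scaler_suml.
under eq_bigr => l _ do under eq_bigr => t _ do rewrite big_split -scaler_suml.
under eq_bigr => l _ do rewrite big_split -scaler_suml.
rewrite big_split -scaler_suml; congr (_ + _).
transitivity (\sum_(l < k.+1) (l == k :> nat)%:R *:
    \sum_(t < l.+1) g (epsA, t : nat) (epsA, (l - t)%N)).
  apply: eq_bigr => l _; rewrite scaler_sumr; apply: eq_bigr => t _.
  transitivity (\sum_(s < t.+1) (s == t :> nat)%:R *:
    ((l == k :> nat)%:R *: g (epsA, s : nat) (epsA, (l - t)%N))).
    apply: eq_bigr => s _.
    by rewrite (sum_pred1 (fun r => _ *: (_ *: g (_, _ - r)%N _))) // subn0.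
  by rewrite (sum_pred1 (fun s => _ *: g (_, s) _)).
by rewrite (sum_pred1 (fun l => \sum_(t < l.+1) g (_, t : nat) (_, (l - t)%N))).
Qed.

(** The main terms have the vertex eps 1 1, so all inputs go to the outputs,
    which start with eps. The remaining term, present when k = n - 1, has
    both outputs equal to the unit; it drops out of the Weyl algebra, where
    the square of an odd generator vanishes. *)
Lemma coproduct_cell_eps k : (k < n)%N -> exists c : K,
  coproduct_cell K n (epsA, k) =
  \sum_(t < k.+1) << ((epsA, t : nat), (epsA, (k - t)%N)) >>
  + c *: << ((unitA, 0%N), (unitA, 0%N)) >>.
Proof.
move=> kn.
have [c cE] := coproduct_sum_eps (fun x y => << (x, y) >> : chain2 K) kn.
exists c; rewrite -cE coproduct_cellE size_word; reflexivity.
Qed.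

(** Outputs eps and eps mean that both edges bring a unit to the vertex,
    which already carries the unit a0. *)
Lemma coproduct_cell_unit k i j :
  (coproduct_cell K n (unitA, k))@_((epsA, i), (epsA, j)) = 0.
Proof.
rewrite coproduct_cellE size_word.
rewrite mcoeff_sum big1 // => l _; rewrite mcoeff_sum big1 // => t _.
rewrite mcoeff_sum big1 // => s _; rewrite mcoeff_sum big1 // => r _.
rewrite mcoeff_sum big1 // => p _; rewrite mcoeff_sum big1 // => q _.
rewrite mcoeffZ mcoeffU !xpair_eqE /dualA.
by case: p q => [] [] /=;
  rewrite ?andbF ?mulr0n ?mulr0 // coproduct_term_unit // mul0r.
Qed.

End Coproduct.

(** * The two ribbon graphs of genus one *)

Section Ribbon.
Variables (K : fieldType) (n : nat).

Notation units := (count_mem unitA).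

Lemma all_reshape (T : Type) (P : pred T) sh (s : seq T) :
  all P s -> all (all P) (reshape sh s).
Proof.
elim: sh s => //= m sh IH s; rewrite -{1}(cat_take_drop m s) all_cat.
by case/andP=> -> /IH ->.
Qed.

Lemma all_even_label m k : all (fun x : letter => ~~ x.2) (label m (nseq k epsA)).
Proof. by rewrite /label size_nseq; elim: k m => //= k IH m; exact: IH. Qed.

Lemma size_label m w : size (label m w) = size w.
Proof. by rewrite size_zip size_iota minnn. Qed.

Lemma units_vertex (L : nat -> letter) (f : nat -> nat)
    (blocks : seq (seq letter)) v :
  all (all (fun x : letter => ~~ x.2)) blocks ->
  units [seq x.2 | x <- flatten [seq L h :: nth [::] blocks (f h) | h <- v]]
  = sumn [seq nat_of_bool (L h).2 | h <- v].
Proof.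
move=> evb; elim: v => //= h v IH; rewrite map_cat count_cat IH.
rewrite eqb_id; congr (_ + _)%N; rewrite -[RHS]add0n; congr (_ + _)%N.
have: all (fun x : letter => ~~ x.2) (nth [::] blocks (f h)).
  have [lt|ge] := ltnP (f h) (size blocks); last by rewrite nth_default.
  exact: (allP evb) (mem_nth _ lt).
by elim: (nth _ _ _) => //= x b IHb /andP[/negbTE -> /IHb].
Qed.

Lemma size_vertex (L : nat -> letter) (f : nat -> nat)
    (blocks : seq (seq letter)) v :
  size [seq x.2 | x <- flatten [seq L h :: nth [::] blocks (f h) | h <- v]]
  = sumn [seq (nth 0 (shape blocks) (f h)).+1 | h <- v]%N.
Proof.
elim: v => //= h v IH; rewrite map_cat size_cat IH size_map.
by rewrite nth_shape.
Qed.

(** The factor of a summand at the vertex v depends, as far as vanishing is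
    concerned, only on the number u of units and the number m of letters
    around v. As the inputs placed in the corners are all eps, u is
    determined by the colouring of the edges. *)
Lemma rho_cell_eq0 G x :
  (forall col sh, size col = size (redges G) -> size sh = size (rface G) ->
     sumn sh = x.2 ->
     ~ forall v, v \in rvertices G ->
       let u := sumn [seq nat_of_bool (rletter G col x.1 h).2 | h <- v] in
       let m := sumn [seq (nth 0 sh (index h (rface G))).+1 | h <- v]%N in
       (u = 0 /\ m = n.+2)%N \/ (u = 2 /\ m = 3)%N) ->
  rho_cell G K n x = 0.
Proof.
move=> H; rewrite /rho_cell big1 // => col _; rewrite big1 // => sh /eqP shx.
set s := [seq val i | i <- sh]; apply/eqP; apply: contra_notT (H col s _ _ shx).
- rewrite /contract mulf_eq0 negb_or => /andP[_]; rewrite prodf_seq_neq0.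
  move=> /allP cten_neq0 v vG /=.
  set L := rletter G col x.1; set f := fun h => index h (rface G).
  set a := behead _ in cten_neq0.
  have {}cten_neq0 := cten_neq0 _ (map_f _ vG).
  have := cten_supp cten_neq0.
  rewrite (size_vertex L f) (units_vertex L f); last first.
    exact/all_reshape/all_even_label.
  by rewrite reshapeKl // size_label /= size_nseq shx.
- by rewrite size_tuple.
- by rewrite size_map size_tuple.
Qed.

(** The vertex has valence at least five and carries a unit of each edge. *)
Lemma rho_cell_G3 x : rho_cell G3 K n x = 0.
Proof.
have faceE : rface G3 = [:: 0; 3; 2; 1; 4]%N by vm_compute.
apply: rho_cell_eq0 => col sh; rewrite faceE {faceE} => szc _ _.
have [s [t ->]] : exists s t, col = [:: s; t].
  by case: col szc => [|s [|t []]] // _; exists s, t.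
move=> /(_ _ (mem_head _ _)) /=.
by case: s t => [] [] /=; lia.
Qed.

(** The four edges bring four units. As every vertex carries zero or two of
    them, the leg is eps, two vertices are trivalent, and the third has n + 2
    letters. Of the 9 + k letters this leaves k = n - 1. *)
Lemma rho_cell_G2 x :
  ~~ ((x.1 == epsA) && (x.2.+1 == n)) -> rho_cell G2 K n x = 0.
Proof.
have faceE : rface G2 = [:: 0; 7; 3; 6; 1; 5; 8; 4; 2]%N by vm_compute.
case: x => a0 k xn; apply: rho_cell_eq0 => col sh.
rewrite faceE {faceE} => szc szs shk.
have [s1 [s2 [s3 [s4 ->]]]] : exists s1 s2 s3 s4, col = [:: s1; s2; s3; s4].
  by case: col szc => [|s1 [|s2 [|s3 [|s4 []]]]] // _; exists s1, s2, s3, s4.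
move=> H; have := H _ (mem_head _ _); have := H [:: 3; 4; 5]%N erefl.
have := H [:: 6; 7; 8]%N erefl; move: xn szs shk => {H szc col} /=.
do 9![case: sh => // ? sh]; case: sh => //= xn _.
case: s1 s2 s3 s4 a0 xn => [] [] [] [] []; rewrite /dualA /=; lia.
Qed.

End Ribbon.

(** * Derivations of polynomial rings in infinitely many variables *)

Section Extension.
Variables (T : choiceType) (A : nzRingType).

Lemma malg_ind (P : {malg A[T]} -> Prop) :
  P 0 -> (forall x y, P x -> P y -> P (x + y)) ->
  (forall a t, P << a *g t >>) -> forall x, P x.
Proof.
move=> P0 PD PU x; rewrite [x]monalgE.
by elim/big_ind: _.
Qed.

Lemma monalgUZ a (t : T) : << a *g t >> = a *: << t >> :> {malg A[T]}.
Proof.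
apply/malgP => u; rewrite mcoeffZ !mcoeffU.
by case: eqP => _; rewrite ?mulr1 ?mulr0.
Qed.

Variable (W : lmodType A) (f : T -> W).

Definition ext (x : {malg A[T]}) : W := \sum_(t <- msupp x) x@_t *: f t.

Let h t a : W := a *: f t.
Let h0 t : h t 0 = 0. Proof. exact: scale0r. Qed.
Let hD t a b : h t (a + b) = h t a + h t b. Proof. exact: scalerDl. Qed.

Lemma extD x y : ext (x + y) = ext x + ext y.
Proof. exact: (addextD h0 hD). Qed.

Lemma extZ a x : ext (a *: x) = a *: ext x.
Proof.
rewrite [LHS](addextEw h0 (msuppZ_le a x)) scaler_sumr.
by apply: eq_bigr => t _; rewrite mcoeffZ /h scalerA.
Qed.

Lemma extU a t : ext << a *g t >> = a *: f t.
Proof. exact: (addextU h0). Qed.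

Lemma ext0 : ext 0 = 0.
Proof. exact: (addext0 h). Qed.

End Extension.

Section AbstractLeibniz.
Variables (A : comNzRingType) (V : comAlgType A).

Lemma scaleMn_Leibniz (a : A) (k l : nat) (p q r x y : V) :
  (k != 0%N -> r = x * q) -> (l != 0%N -> r = p * y) ->
  (a *+ (k + l)) *: r = (a *+ k) *: x * q + p * ((a *+ l) *: y).
Proof.
move=> rx ry; rewrite mulrnDr scalerDl; congr (_ + _).
  have [->|/rx ->] := eqVneq k 0%N; first by rewrite !mulr0n !scale0r mul0r.
  by rewrite scalerAl.
have [->|/ry ->] := eqVneq l 0%N; first by rewrite !mulr0n !scale0r mulr0.
by rewrite scalerAr.
Qed.

Variables (T : Type) (e d : T -> V) (D : V -> V).

(** Both sides are bilinear, so the rule follows from its instances on the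
    spanning family e. *)
Lemma Leibniz_of_basis :
  (forall P : V -> Prop, P 0 -> (forall x y, P x -> P y -> P (x + y)) ->
    (forall a t, P (a *: e t)) -> forall x, P x) ->
  (forall x y, D (x + y) = D x + D y) -> (forall a x, D (a *: x) = a *: D x) ->
  (forall t, D (e t) = d t) ->
  (forall s t, D (e s * e t) = d s * e t + e s * d t) ->
  forall x y, D (x * y) = D x * y + x * D y.
Proof.
move=> ind DD DZ De DM x y.
have D0 : D 0 = 0 by have := DZ 0 0; rewrite !scale0r.
move: x; apply: (ind) => [|x x' IH IH'|a s].
- by rewrite !(mul0r, D0, add0r).
- by rewrite mulrDl !DD IH IH' !mulrDl addrACA.
move: y; apply: (ind) => [|y y' IH IH'|b t].
- by rewrite !(mulr0, D0, add0r).
- by rewrite mulrDr !DD IH IH' !mulrDr addrACA.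
by rewrite -scalerAl -scalerAr !DZ DM !De !scalerDr -!scalerAl -!scalerAr.
Qed.

End AbstractLeibniz.

Section Derivation.
Variables (I : choiceType) (A : comNzRingType).

Notation poly := {malg A[{cmonom I}]}.
Notation mul m1 m2 := (@mmul {cmonom I} m1 m2).

Definition var (v : I) : poly := << ucm v >>.

Lemma monalgUM (m1 m2 : {cmonom I}) :
  << mul m1 m2 >> = << m1 >> * << m2 >> :> poly.
Proof. by rewrite malgM_def fgmulUU mulr1. Qed.

Variable c : I -> A.

Definition der_mon (m : {cmonom I}) : poly :=
  \sum_(v <- finsupp m) (c v *+ m v) *: << divcm m (ucm v) >>.

(** The derivation with c v as the value at the variable v. *)
Definition der : poly -> poly := ext der_mon.

Lemma der_monEw (d : {fset I}) (m : {cmonom I}) : (finsupp m `<=` d)%fset ->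
  der_mon m = \sum_(v <- d) (c v *+ m v) *: << divcm m (ucm v) >>.
Proof.
move=> md; apply: big_fset_incl => // v _ vm.
have /eqP -> : m v == 0%N by rewrite cmE_eq0.
by rewrite mulr0n scale0r.
Qed.

Lemma divcm_mul v (p q : {cmonom I}) : p v != 0%N ->
  divcm (mul p q) (ucm v) = mul (divcm p (ucm v)) q.
Proof.
move=> pv; apply/eqP/cmP => w; rewrite divcmE !cmM divcmE ucmE.
by case: eqP => [<-|_]; lia.
Qed.

(** In the sum over the support of both monomials each term is the Leibniz
    rule for one variable; a term whose exponent is zero vanishes although
    the truncated quotient of monomials is meaningless there. *)
Lemma der_monM m1 m2 :
  der_mon (mul m1 m2) = der_mon m1 * << m2 >> + << m1 >> * der_mon m2.
Proof.
set d := (finsupp m1 `|` finsupp m2)%fset.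
rewrite (@der_monEw d) ?mdomD // (@der_monEw d m1) ?fsubsetUl //.
rewrite (@der_monEw d m2) ?fsubsetUr // mulr_suml mulr_sumr -big_split.
apply: eq_bigr => v _; rewrite cmM; apply: scaleMn_Leibniz => mv.
  by rewrite divcm_mul // monalgUM.
by rewrite [mul m1 m2]mulmC divcm_mul // mulmC monalgUM.
Qed.

Lemma derD p q : der (p + q) = der p + der q. Proof. exact: extD. Qed.

Lemma derZ a p : der (a *: p) = a *: der p. Proof. exact: extZ. Qed.

Lemma der_monom m : der << m >> = der_mon m.
Proof. by rewrite /der extU scale1r. Qed.

Lemma derM p q : der (p * q) = der p * q + p * der q.
Proof.
apply: (@Leibniz_of_basis _ _ _ (fun m => << m >>) der_mon).
- move=> P P0 PD PU.
  by apply: malg_ind => // a t; rewrite monalgUZ.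
- exact: derD.
- exact: derZ.
- exact: der_monom.
by move=> s t; rewrite -monalgUM der_monom der_monM.
Qed.

Lemma der_var v : der (var v) = c v *: 1.
Proof.
rewrite /der /var extU scale1r /der_mon mdomU big_seq_fset1 cmUU mulr1n.
congr (_ *: << _ >>); apply/eqP/cmP => w.
by rewrite divcmE ucmE subnn cm1.
Qed.

End Derivation.

Section Monomials.
Variables (I : choiceType) (A : comNzRingType).
Notation poly := {malg A[{cmonom I}]}.

Lemma cmonom_ind (P : {cmonom I} -> Prop) :
  P (@mone {cmonom I}) -> (forall v m, P m -> P (@mmul {cmonom I} (ucm v) m)) ->
  forall m, P m.
Proof.
move=> P1 PM m; have [k] := ubnP (mdeg m); elim: k m => // k IH m.
have [m0|/fset0Pn[v]] := eqVneq (finsupp m) fset0.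
  have -> : m = @mone {cmonom I}; last by move=> _; exact: P1.
  by apply/eqP/cmP => v; rewrite cm1; apply/eqP; rewrite cmE_eq0 m0 inE.
rewrite -cmE_neq0 => mv.
have mE : m = @mmul {cmonom I} (ucm v) (divcm m (ucm v)).
  apply/eqP/cmP => w; rewrite cmM divcmE ucmE.
  by case: eqP => [<-|_]; lia.
move=> lt; rewrite mE; apply: PM; apply: IH.
by move: lt; rewrite {1}mE mdegM mdegU.
Qed.

Lemma polyvar_ind (P : poly -> Prop) :
  P 1 -> (forall a p, P p -> P (a *: p)) ->
  (forall p q, P p -> P q -> P (p + q)) ->
  (forall v p, P p -> P (var A v * p)) -> forall p, P p.
Proof.
move=> P1 PZ PD PM; elim/malg_ind => [||a m].
- by rewrite -(scale0r 1); exact: PZ.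
- exact: PD.
rewrite monalgUZ; apply: PZ; elim/cmonom_ind: m => [|v m Pm]; first exact: P1.
by rewrite monalgUM; exact: PM.
Qed.

Lemma monomE (m : {cmonom I}) :
  << m >> = \prod_(v <- finsupp m) var A v ^+ m v :> poly.
Proof.
have key (d : {fset I}) : (finsupp m `<=` d)%fset ->
  << m >> = \prod_(v <- d) var A v ^+ m v :> poly; last exact: key.
elim/cmonom_ind: m d => [|w m IH] d md.
  by rewrite big1 // => v _; rewrite cm1.
rewrite monalgUM (IH d); last first.
  by apply: fsubset_trans md; rewrite mdomD fsubsetUr.
have wd : w \in d by apply: (fsubsetP md); rewrite mdomD mdomU inE fset11.
rewrite !(big_fsetD1 w wd) /= mulrA -exprS cmM cmUU; congr (_ * _).
apply: eq_big_seq => v; rewrite !inE => /andP[vw _].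
by rewrite cmM cmU eq_sym (negbTE vw).
Qed.

End Monomials.

(** * Power series in lambda *)

Section PowerSeries.
Variable K : comNzRingType.
Implicit Types (a b : K) (f : pser K).

Lemma coef_psD f g i : (f + g) i = f i + g i. Proof. by []. Qed.

Lemma coef_psCM a f i : (psC a * f) i = a * f i.
Proof.
rewrite [LHS]big_ord_recl subn0 big1 ?addr0 // => j _.
by rewrite /psC /= mul0r.
Qed.

Lemma psCD a b : psC (a + b) = psC a + psC b.
Proof.
apply/funext => i; rewrite coef_psD /psC.
by case: eqP => // _; rewrite addr0.
Qed.

Lemma psCM a b : psC (a * b) = psC a * psC b.
Proof.
apply/funext => i; rewrite coef_psCM /psC.
by case: eqP => // _; rewrite mulr0.
Qed.

Lemma psC1 : psC 1 = 1 :> pser K. Proof. by []. Qed.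

Lemma psC0 : psC 0 = 0 :> pser K.
Proof. by apply/funext => i; rewrite /psC; case: eqP. Qed.

Lemma psCN a : psC (- a) = - psC a.
Proof. by apply/eqP; rewrite -subr_eq0 opprK -psCD addNr psC0. Qed.

Lemma psC_sum I r (P : pred I) (F : I -> K) :
  psC (\sum_(i <- r | P i) F i) = \sum_(i <- r | P i) psC (F i).
Proof. exact: (big_morph _ psCD psC0). Qed.

Lemma coef_psXM f i : (psX K * f) i.+1 = f i.
Proof.
rewrite [LHS]big_ord_recl {1}/psX mul0r add0r big_ord_recl /psX /= mul1r.
by rewrite /bump subSS subn0 big1 ?addr0 // => j _; rewrite mul0r.
Qed.

Lemma coef_psXM0 f : (psX K * f) 0%N = 0.
Proof. by rewrite [LHS]big_ord1 /psX mul0r. Qed.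

End PowerSeries.

(** * The residue pairing *)

Section Coefficients.
Variable K : fieldType.
Implicit Types x y : laurent K.

(** The coefficient of u^a eps|eps^i. For i < n these coefficients are the
    coordinates of x modulo the radical of the residue pairing. *)
Definition epsc x (a : int) (i : nat) : K := (x a)@_(epsA, i).

Lemma epscD x y a i : epsc (x + y) a i = epsc x a i + epsc y a i.
Proof. exact: mcoeffD. Qed.

Lemma epscZ (c : K) x a i : epsc (c *: x) a i = c * epsc x a i.
Proof. exact: mcoeffZ. Qed.

Lemma laurent_bounded x : exists N : nat, forall a : int, a < - N%:Z -> x a = 0.
Proof.
case: x => f /= /asboolP[N fN]; exists `|N|%N => a aN; apply: fN.
by apply: lt_le_trans aN _; lia.
Qed.

Definition pole_order x : nat := projT1 (cid (laurent_bounded x)).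

Lemma pole_orderP x (a : int) : a < - (pole_order x)%:Z -> x a = 0.
Proof. exact: (projT2 (cid (laurent_bounded x))). Qed.

Variable n : nat.

Lemma linext_eps (W : lmodType K) (f : cell -> W) (x : chain K) :
  (forall c, ~~ ((c.1 == epsA) && (c.2 < n)%N) -> f c = 0) ->
  linext f x = \sum_(i < n) x@_(epsA, i : nat) *: f (epsA, i : nat).
Proof.
move=> f0.
change (ext f x = \sum_(i < n) x@_(epsA, i : nat) *: f (epsA, i : nat)).
elim/malg_ind: x => [|x y IHx IHy|a c].
- by rewrite ext0 big1 // => i _; rewrite mcoeff0 scale0r.
- rewrite extD IHx IHy -big_split; apply: eq_bigr => i _.
  by rewrite mcoeffD scalerDl.
rewrite extU; case: c => u m.
have [/andP[/eqP u0 mn]|um] := boolP ((u == epsA) && (m < n)%N).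
  rewrite {}u0.
  rewrite (bigD1 (Ordinal mn)) //= mcoeffUU big1 ?addr0 // => i im.
  rewrite mcoeffU xpair_eqE eqxx /=.
  rewrite (_ : (m == i)%N = false) ?mulr0n ?scale0r //.
  by apply: contraNF im => /eqP mi; apply/eqP/val_inj.
rewrite f0 // scaler0 big1 // => i _; rewrite mcoeffU xpair_eqE.
rewrite (_ : (_ && _) = false) ?scale0r //.
by apply: contraNF um => /andP[/eqP -> /eqP ->]; rewrite eqxx ltn_ord.
Qed.

Hypothesis charK : [pchar K] =i pred0.

Lemma natS_neq0 m : m.+1%:R != 0 :> K.
Proof. by have /pcharf0P -> := charK. Qed.

Lemma mukai_word_eps i j : mukai_word K n (word (epsA, i)) (word (epsA, j)) =
  ((i + j).+1 == n)%:R.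
Proof.
rewrite mukai_eps; case: eqP => // <-.
by rewrite divff ?natS_neq0.
Qed.

Lemma mukai_word_unit (c d : cell) : unitA \in [:: c.1; d.1] ->
  mukai_word K n (word c) (word d) = 0.
Proof.
case: c d => [] [] i [] [] j; rewrite ?inE //= => _.
- exact: mukai_unit.
- exact: mukai_mixed.
- exact: mukai_mixed.
Qed.

(** The cells 1|eps^k, and eps|eps^k with k >= n, span the radical of the
    pairing. *)
Lemma mukaiE (x y : chain K) : mukai n x y =
  \sum_(i < n) x@_(epsA, (n - i.+1)%N) * y@_(epsA, i : nat).
Proof.
have -> : mukai n x y =
  linext (fun c => linext (fun d => mukai_word K n (word c) (word d) : K^o) y) x.
  rewrite /mukai /linext; apply: eq_bigr => c _; rewrite scaler_sumr.
  by apply: eq_bigr => d _; rewrite scalerA.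
rewrite linext_eps; last first.
  move=> c cn; rewrite /linext big1 // => d _.
  case: c cn => [] [] i /= => [_|].
    by rewrite mukai_word_unit ?scaler0 // inE eqxx.
  rewrite -leqNgt => ni; case: d => [] [] j.
    by rewrite mukai_word_unit ?scaler0 // !inE eqxx orbT.
  by rewrite mukai_word_eps (_ : (_ == _) = false) ?scaler0 //; lia.
rewrite (reindex_inj rev_ord_inj); apply: eq_bigr => i _ /=.
congr (_ * _); rewrite linext_eps; last first.
  case=> [] [] j /= => [_|]; first by rewrite mukai_word_unit // !inE eqxx orbT.
  rewrite -leqNgt => nj; rewrite mukai_word_eps.
  by rewrite (_ : (_ == _) = false) //; have := ltn_ord i; lia.
rewrite (bigD1 i) //= big1 ?addr0 => [|j ji]; rewrite mukai_word_eps.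
  rewrite (_ : (_ == _) = true) ?[_ *: _]mulr1 //; have := ltn_ord i; lia.
rewrite (_ : (_ == _) = false) ?[_ *: _]mulr0 //; apply: contraNF ji => /eqP E.
by apply/eqP/val_inj => /=; move: (ltn_ord i) (ltn_ord j) E; lia.
Qed.

(** The part of the residue pairing of the regular part of x with the polar
    part of y. *)
Definition half_res (N : nat) x y : K :=
  \sum_(a < N) \sum_(i < n)
    (-1) ^+ a * epsc x a (n - i.+1) * epsc y (- a.+1%:Z) i.

(** The nonnegative powers of u in x contribute the first term and the
    negative ones the second; the reflection i -> n - 1 - i, and the sign of
    (-1)^(-1-a) relative to (-1)^a, turn the latter into the same expression
    with x and y exchanged. *)
Lemma res_hresE N x y : (pole_order x <= N)%N -> (pole_order y <= N)%N ->
  res_hres n x y = half_res N x y - half_res N y x.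
Proof.
move=> xN yN.
(* Outside the range of exponents -N, ..., N - 1 one of the two factors is 0. *)
pose r := [seq Posz a | a <- iota 0 N] ++ [seq Negz a | a <- iota 0 N].
rewrite /res_hres (fsbigE r) //; first last.
- move=> a _; rewrite mem_cat negb_or => /andP[aP aN].
  have mukai0l (z : chain K) : mukai n 0 z = 0.
    by rewrite mukaiE big1 // => i _; rewrite mcoeff0 mul0r.
  have mukai0r (z : chain K) : mukai n z 0 = 0.
    by rewrite mukaiE big1 // => i _; rewrite mcoeff0 mulr0.
  case: a aP aN => a aP aN.
    rewrite (pole_orderP (x := y)) ?mukai0r ?mulr0 //.
    have : (N <= a)%N.
      by rewrite leqNgt; apply: contraNN aP => aN'; rewrite map_f // mem_iota.
    lia.
  rewrite (pole_orderP (x := x)) ?mukai0l ?mulr0 //.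
  have : (N <= a)%N.
    by rewrite leqNgt; apply: contraNN aN => aN'; rewrite map_f // mem_iota.
  by rewrite NegzE; lia.
- rewrite cat_uniq !map_inj_uniq ?iota_uniq /=; try by move=> ? ? [].
  by rewrite andbT; apply/hasPn => _ /mapP[a _ ->]; apply/negP => /mapP[].
rewrite /r; have -> : iota 0 N = index_iota 0 N by rewrite /index_iota subn0.
rewrite big_cat !big_map !big_mkord /half_res -sumrN /=; congr (_ + _).
  apply: eq_big => [a|a _]; first by rewrite in_setT.
  rewrite mukaiE mulr_sumr; apply: eq_bigr => i _.
  by rewrite mulrA /epsc; congr (_ * _ * (y _)@__); lia.
apply: eq_big => [a|a _]; first by rewrite in_setT.
rewrite mukaiE mulr_sumr -sumrN (reindex_inj rev_ord_inj).
apply: eq_bigr => i _ /=.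
have -> : (n - (n - i.+1).+1)%N = i by have := ltn_ord i; lia.
have -> : -1 - Negz a = a by rewrite NegzE; lia.
have -> : (-1) ^ Negz a = - (-1) ^+ a :> K.
  by rewrite NegzE -exprnN -exprVn invrN invr1 exprS mulN1r.
rewrite NegzE /epsc; ring.
Qed.

End Coefficients.

(** * The differential and the relations on closed chains *)

Section Sums.
Variables (V : zmodType) (n : nat).

Lemma sum_msupp_eps (K : fieldType) (x : chain K) (F : cell -> V) :
  (forall c, c \in msupp x -> ~~ ((c.1 == epsA) && (c.2 < n)%N) -> F c = 0) ->
  (forall i, x@_(epsA, i) = 0 -> F (epsA, i) = 0) ->
  \sum_(c <- msupp x) F c = \sum_(i < n) F (epsA, i : nat).
Proof.
move=> F0 x0.
pose H := [fset (epsA, val i) | i in 'I_n]%fset.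
transitivity (\sum_(c <- H) F c); last first.
  rewrite big_imfset /=; last by move=> i j _ _ [] /val_inj.
  by rewrite big_enum.
transitivity (\sum_(c <- (msupp x `|` H)%fset) F c).
  apply: big_fset_incl; first exact: fsubsetUl.
  move=> c; rewrite in_fsetU => /orP[-> //|/imfsetP[i _ ->]].
  by move/mcoeff_outdom; exact: x0.
apply/esym/big_fset_incl; first exact: fsubsetUr.
move=> c; rewrite in_fsetU => /orP[cx|-> //] cH; apply: F0 => //.
apply: contra cH; case: c {cx} => u m /= /andP[/eqP -> mn].
by apply/imfsetP; exists (Ordinal mn).
Qed.

(** The pairs (k, t) with t <= k < n correspond to the pairs (i, j) = (t, k -
    t) with i + j < n. *)
Lemma triangle (F : nat -> nat -> V) :
  \sum_(k < n) \sum_(t < k.+1) F t (k - t)%N =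
  \sum_(i < n) \sum_(j < n | (i + j < n)%N) F i j.
Proof.
transitivity (\sum_(k < n) \sum_(t < n | (t <= k)%N) F t (k - t)%N).
  apply: eq_bigr => k _.
  by rewrite (big_ord_widen n (fun t => F t (k - t)%N)).
rewrite (exchange_big_dep xpredT) //=; apply: eq_bigr => t _.
rewrite -(big_geq_mkord t n xpredT (fun k => F t (k - t)%N)).
rewrite -{1}[val t]add0n big_addn big_mkord.
rewrite (big_ord_widen n (fun j => F t (j + t - t)%N)) ?leq_subr //.
by apply: eq_big => j; rewrite ?addnK // ltn_subRL.
Qed.

End Sums.

Section Boundary.
Variables (K : fieldType) (n : nat).

(** Both b and B take values in the span of the cells 1|eps^k, so the
    differential vanishes modulo the radical of the pairing. *)
Lemma epsc_ldiff (x : laurent K) a i : epsc (ldiff n x) a i = 0.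
Proof.
rewrite /epsc /= mcoeffD /hochb /connB /linext !mcoeff_sum.
rewrite !big1 ?addr0 // => -[u m] _; rewrite mcoeffZ.
  rewrite /B_cell; case: ifP => _; last by rewrite mcoeff0 mulr0.
  by rewrite mcoeffZ mcoeffU xpair_eqE /= mulr0n !mulr0.
rewrite /b_cell; case: ifP => _; last by rewrite mcoeff0 mulr0.
by rewrite mcoeffU xpair_eqE /= mulr0n mulr0.
Qed.

Lemma hochb_coef (x : chain K) m :
  (hochb n x)@_(unitA, m) = x@_(epsA, (n + m)%N).
Proof.
change ((ext (b_cell K n) x)@_(unitA, m) = x@_(epsA, (n + m)%N)).
elim/malg_ind: x => [|x y IHx IHy|a [u k]].
- by rewrite ext0 !mcoeff0.
- by rewrite extD !mcoeffD IHx IHy.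
rewrite extU mcoeffZ mcoeffU xpair_eqE /b_cell /=.
case: ifP => [/andP[/eqP -> nk]|].
  rewrite mcoeffU xpair_eqE eqxx /= mulr_natr; congr (_ *+ _); lia.
move=> unk; rewrite mcoeff0 mulr0 (_ : (_ && _) = false) //.
by apply: contraFF unk => /andP[/eqP -> /eqP ->]; rewrite eqxx leq_addr.
Qed.

(** As b maps eps|eps^(n+m) to 1|eps^m, it is injective on the span of the
    eps|eps^k with k >= n. *)
Lemma closed_eps (x : laurent K) k : in_Lu x -> ldiff n x = 0 -> (n <= k)%N ->
  epsc x 0 k = 0.
Proof.
move=> x0 dx nk.
have := congr1 (fun y : laurent K => (y 0)@_(unitA, (k - n)%N)) dx.
rewrite /= mcoeffD (x0 (0 - 1)) // /connB linext0 !mcoeff0 addr0.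
by rewrite hochb_coef subnKC.
Qed.

Lemma rho_G2E (x : chain K) : (0 < n)%N ->
  rho G2 n x = x@_(epsA, n.-1) * rho_cell G2 K n (epsA, n.-1).
Proof.
move=> n0; rewrite /rho (@sum_msupp_eps _ n _ x); first last.
- by move=> i ->; rewrite mul0r.
- move=> c _ cn; rewrite rho_cell_G2 ?mulr0 //.
  by apply: contra cn => /andP[-> /eqP <-] /=.
have nn : (n.-1 < n)%N by rewrite prednK.
rewrite (bigD1 (Ordinal nn)) //= big1 ?addr0 // => i ni.
rewrite rho_cell_G2 ?mulr0 //; apply: contra ni => /andP[_ /eqP /= E].
by apply/eqP/val_inj => /=; lia.
Qed.

Lemma rho_G3E (x : chain K) : rho G3 n x = 0.
Proof. by rewrite /rho big1 // => c _; rewrite rho_cell_G3 mulr0. Qed.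

(** Modulo the radical the lift of eps|eps^i is eps|eps^i, as its higher
    terms are multiples of eps|eps^k with k >= n. *)
Lemma epsc_fock_var (v : fockVar n) (a : int) i : (i < n)%N ->
  epsc (fock_var K v) a i = ((a == - v.1.+1%:Z) && (i == v.2 :> nat))%:R.
Proof.
move=> li; change (((split_lift K n v.2) (a - - (v.1.+1)%:Z))@_(epsA, i) =
  ((a == - v.1.+1%:Z) && (i == v.2 :> nat))%:R).
have [->|av] := eqVneq a (- v.1.+1%:Z).
  rewrite subrr /= mcoeffZ mcoeffU xpair_eqE eqxx /=.
  by rewrite /split_coef big_ord0 muln0 !addn0 !mul1r eq_sym.
(* The u^l term of the lift lies in eps|eps^(i + (n + 1) l). *)
case E: (a - - _) => [[|l]|l] /=; [by move: av E; lia| |by rewrite mcoeff0].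
rewrite mcoeffZ mcoeffU xpair_eqE (_ : (_ && _) = false) ?mulr0 //.
by apply/negP => /andP[_ /eqP]; lia.
Qed.

End Boundary.

(** * The action of the Weyl algebra on polynomials *)

Section ActionOfRing.
Variables (W : nzRingType) (V : zmodType) (T : Type) (e : T -> W).
Variable r : W -> V -> V.

(** Both sides are additive in x and in y, so multiplicativity follows from
    its instances on the additively spanning family e. *)
Lemma action_of_basis :
  (forall P : W -> Prop, P 0 -> (forall x y, P x -> P y -> P (x + y)) ->
    (forall t, P (e t)) -> forall x, P x) ->
  (forall x y p, r (x + y) p = r x p + r y p) ->
  (forall x p q, r x (p + q) = r x p + r x q) ->
  (forall s t p, r (e s * e t) p = r (e s) (r (e t) p)) ->
  forall x y p, r (x * y) p = r x (r y p).
Proof.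
move=> ind rDl rDr re x y p.
have r0l q : r 0 q = 0 by apply: (@addrI _ (r 0 q)); rewrite -rDl !addr0.
have r0r z : r z 0 = 0 by apply: (@addrI _ (r z 0)); rewrite -rDr !addr0.
move: x; apply: (ind) => [|x x' IH IH'|s].
- by rewrite mul0r !r0l.
- by rewrite mulrDl !rDl IH IH'.
move: y; apply: (ind) => [|y y' IH IH'|t].
- by rewrite mulr0 !r0l r0r.
- by rewrite mulrDr !rDl IH IH' rDr.
exact: re.
Qed.

End ActionOfRing.

Section Operators.
Variables (K : fieldType) (n : nat).
Hypothesis charK : [pchar K] =i pred0.
Hypothesis n_gt0 : (0 < n)%N.
Variables (V : comAlgType (pser K)) (X : fockVar n -> V).
Variable D : (fockVar n -> pser K) -> V -> V.
Hypothesis indV : forall P : V -> Prop,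
  P 1 -> (forall a p, P p -> P (a *: p)) ->
  (forall p q, P p -> P q -> P (p + q)) ->
  (forall v p, P p -> P (X v * p)) -> forall p, P p.
Hypothesis DD : forall c x y, D c (x + y) = D c x + D c y.
Hypothesis DZ : forall c a x, D c (a *: x) = a *: D c x.
Hypothesis DM : forall c x y, D c (x * y) = D c x * y + x * D c y.
Hypothesis DX : forall c v, D c (X v) = c v *: 1.
Implicit Types (x y : laurent K) (p q : V).

(** Turning scalars into elements of V makes the identities below identities
    of commutative rings. *)
Definition embed (a : pser K) : V := a *: 1.

Lemma scale_embed a p : a *: p = embed a * p.
Proof. by rewrite /embed -scalerAl mul1r. Qed.

Lemma D0 c : D c 0 = 0.
Proof. by have := DZ c 0 0; rewrite !scale0r. Qed.

Lemma D_sum J r (P : pred J) c (F : J -> V) :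
  D c (\sum_(j <- r | P j) F j) = \sum_(j <- r | P j) D c (F j).
Proof. exact: (big_morph _ (DD c) (D0 c)). Qed.

Lemma D1 c : D c 1 = 0.
Proof.
have := DM c 1 1; rewrite !mulr1 mul1r => /(congr1 (fun z => z - D c 1)).
by rewrite addrK subrr.
Qed.

Lemma D_comm c c' p : D c (D c' p) = D c' (D c p).
Proof.
move: p; apply: indV => [|a p|p q|v p].
- by rewrite !D1 !D0.
- by rewrite !DZ => ->.
- by rewrite !DD => -> ->.
rewrite !DM !DX !DD !DM !DX -!scalerAl !DZ !mul1r => ->.
by rewrite !D1 !scaler0 !mul0r !add0r addrCA.
Qed.

Lemma D_lin a c c' p : D (fun v => a * c v + c' v) p = a *: D c p + D c' p.
Proof.
move: p; apply: indV => [|b p|p q|v p].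
- by rewrite !D1 scaler0 addr0.
- by rewrite !DZ => ->; rewrite scalerDr !scalerA mulrC.
- by rewrite !DD => -> ->; rewrite scalerDr addrACA.
rewrite !DM !DX => ->; rewrite !scalerDr addrACA; congr (_ + _).
  by rewrite scalerDl mulrDl scalerAl scalerA.
by rewrite mulrDr scalerAr.
Qed.

Lemma D_cst0 p : D (fun=> 0) p = 0.
Proof.
have := D_lin (-1) (fun=> 0) (fun=> 0) p.
by rewrite mulr0 addr0 scaleN1r addNr.
Qed.

(** The polar part of x, as a linear form in the variables. *)
Definition polar x : V :=
  \sum_(a < pole_order x) \sum_(i < n)
     psC (epsc x (- a.+1%:Z) i) *: X (a : nat, i).

Lemma polarE N x : (pole_order x <= N)%N ->
  polar x = \sum_(a < N) \sum_(i < n)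
              psC (epsc x (- a.+1%:Z) i) *: X (a : nat, i).
Proof.
move=> xN; rewrite /polar.
pose F a := \sum_(i < n) psC (epsc x (- a.+1%:Z) i) *: X (a, i).
rewrite (big_ord_widen N F) //.
rewrite big_mkcond; apply: eq_bigr => a _; case: ltnP => // xa.
rewrite big1 // => i _; rewrite /epsc pole_orderP; last by lia.
by rewrite mcoeff0 psC0 scale0r.
Qed.

Lemma polar_lin (c : K) x y : polar (c *: x + y) = psC c *: polar x + polar y.
Proof.
set N := maxn (pole_order (c *: x + y)) (maxn (pole_order x) (pole_order y)).
rewrite !(@polarE N) ?leq_maxl //; try by rewrite /N; lia.
rewrite scaler_sumr -big_split; apply: eq_bigr => a _.
rewrite scaler_sumr -big_split; apply: eq_bigr => i _ /=.
by rewrite epscD epscZ psCD psCM scalerDl scalerA.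
Qed.

(** The direction of the derivative by which the regular part of x acts: its
    value at the variable v is the residue pairing of x with v. *)
Definition hol x (v : fockVar n) : pser K :=
  psC ((-1) ^+ v.1 * epsc x v.1 (n - v.2.+1)).

Lemma hol_lin (c : K) x y :
  hol (c *: x + y) = (fun v => psC c * hol x v + hol y v).
Proof.
apply/funext => v; rewrite /hol epscD epscZ -psCM -psCD; congr psC; ring.
Qed.

Definition quad (x : laurent K) : V :=
  \sum_(i < n) \sum_(j < n | (i + j < n)%N)
     psC (epsc x 0 (i + j)) *: (X (0%N, i) * X (0%N, j)).

Variable tau : K.

(** The first order correction of the relation for a closed x in L[[u]]. The
    first summand comes from the coproduct and the second one from the graph
    G2, whose value on eps|eps^(n-1) enters through tau; G3 contributes
    nothing. *)
Definition potential x : V :=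
  psC 2%:R^-1 *: quad x + psC (tau * epsc x 1 n.-1) *: 1.

Lemma potential_lin (c : K) x y :
  potential (c *: x + y) = psC c *: potential x + potential y.
Proof.
rewrite /potential scalerDr addrACA; congr (_ + _); last first.
  by rewrite scalerA -psCM -scalerDl -psCD epscD epscZ; congr (psC _ *: _); ring.
rewrite scalerA mulrC -scalerA -scalerDr; congr (_ *: _).
rewrite /quad scaler_sumr -big_split; apply: eq_bigr => i _.
rewrite scaler_sumr -big_split; apply: eq_bigr => j _ /=.
by rewrite epscD epscZ psCD psCM scalerDl scalerA.
Qed.

Lemma D_polar y x N : (pole_order x <= N)%N -> (pole_order y <= N)%N ->
  D (hol y) (polar x) = psC (half_res n N y x) *: 1.
Proof.
move=> xN yN; rewrite (polarE xN) D_sum psC_sum scaler_suml.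
apply: eq_bigr => a _.
rewrite D_sum psC_sum scaler_suml; apply: eq_bigr => i _.
by rewrite DZ DX scalerA -psCM; congr (psC _ *: _); rewrite mulrC.
Qed.

(** Under i -> n - 1 - i - j the arguments i + j and n - 1 - i are exchanged.
    This is the symmetry of the Frobenius algebra K[x]/x^n. *)
Lemma hessian_sym (f g : nat -> K) (j : nat) : (j < n)%N ->
  \sum_(i < n | (i + j < n)%N) f (i + j)%N * g (n - i.+1)%N =
  \sum_(i < n | (i + j < n)%N) g (i + j)%N * f (n - i.+1)%N.
Proof.
move=> jn.
have red (h : nat -> K) :
    \sum_(i < n | (i + j < n)%N) h i = \sum_(0 <= i < n - j) h i.
  rewrite big_mkord (big_ord_widen n) ?leq_subr //.
  by apply: eq_bigl => i; rewrite ltn_subRL addnC.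
rewrite (red (fun i => f (i + j)%N * g (n - i.+1)%N)).
rewrite (red (fun i => g (i + j)%N * f (n - i.+1)%N)) big_nat_rev.
apply: eq_big_nat => i; rewrite add0n => /andP[_ ij].
by rewrite mulrC; congr (g _ * f _); lia.
Qed.

Lemma D_quad y x : D (hol y) (quad x) =
  2%:R *: \sum_(j < n) psC (\sum_(i < n | (i + j < n)%N)
     epsc x 0 (i + j) * epsc y 0 (n - i.+1)) *: X (0%N, j).
Proof.
pose F (i j : 'I_n) :=
  psC (epsc x 0 (i + j) * epsc y 0 (n - i.+1)) *: X (0%N, j).
transitivity (\sum_(i < n) \sum_(j < n | (i + j < n)%N) (F i j + F j i)).
  rewrite D_sum; apply: eq_bigr => i _; rewrite D_sum; apply: eq_bigr => j _.
  rewrite DZ DM !DX /F /hol expr0 !mul1r scalerDr -scalerAl -scalerAr mul1r mulr1.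
  by rewrite !scalerA -!psCM [(j + i)%N]addnC.
under eq_bigr => i _ do rewrite big_split.
rewrite big_split /=; set S := (X in X + _).
have -> : \sum_(i < n) \sum_(j < n | (i + j < n)%N) F j i = S.
  rewrite (exchange_big_dep xpredT) //=; apply: eq_bigr => i _.
  by apply: eq_bigl => j; rewrite addnC.
rewrite -mulr2n -scaler_nat; congr (_ *: _).
rewrite /S (exchange_big_dep xpredT) //=; apply: eq_bigr => j _.
by rewrite psC_sum scaler_suml.
Qed.

(** This symmetry is what makes the deformed relations consistent: the
    relations for two commuting closed elements x and y require that x acts
    on the correction of y as y acts on the correction of x. *)
Lemma D_potential_sym x y : D (hol y) (potential x) = D (hol x) (potential y).
Proof.
rewrite /potential !DD !DZ !D1 !scaler0 !addr0 !D_quad; congr (_ *: (_ *: _)).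
apply: eq_bigr => j _; congr (psC _ *: _).
exact: (hessian_sym (epsc x 0) (epsc y 0)).
Qed.

(** The polar part of x acts by multiplication, the regular part by a
    derivative, corrected by lambda times the potential so that the relation
    x = lambda T(x) holds on 1. *)
Definition fock_op x (p : V) : V :=
  polar x * p + D (hol x) p + psX K *: (potential x * p).

Lemma fock_op_lin a x p q :
  fock_op x (a *: p + q) = a *: fock_op x p + fock_op x q.
Proof. rewrite /fock_op DD DZ !scale_embed; ring. Qed.

Lemma fock_op_arg_lin (c : K) x y p :
  fock_op (c *: x + y) p = psC c *: fock_op x p + fock_op y p.
Proof.
rewrite /fock_op polar_lin potential_lin hol_lin D_lin !scale_embed; ring.
Qed.

(** The brackets of derivatives with polar parts give the two halves of the
    residue pairing. Those of derivatives with potentials cancel by symmetry. *)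
Lemma fock_op_comm x y p :
  fock_op x (fock_op y p) - fock_op y (fock_op x p) = psC (res_hres n x y) *: p.
Proof.
set N := maxn (pole_order x) (pole_order y).
rewrite (@res_hresE _ _ charK N) ?leq_maxl ?leq_maxr // psCD psCN scalerBl.
rewrite /fock_op !DD !DZ !DM (D_comm (hol x)) (D_potential_sym x y).
rewrite (D_polar (N := N)) ?leq_maxl ?leq_maxr //.
rewrite (D_polar (N := N)) ?leq_maxl ?leq_maxr //.
rewrite !scale_embed; ring.
Qed.

Lemma fock_op_regular x : (forall a : int, 0 <= a ->
    forall i, (i < n)%N -> epsc x a i = 0) ->
  forall p, fock_op x p = polar x * p.
Proof.
move=> x0 p; rewrite /fock_op.
have -> : hol x = fun=> 0.
  apply/funext => v; rewrite /hol x0 ?mulr0 ?psC0 //.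
  by have := ltn_ord v.2; lia.
have -> : potential x = 0.
  rewrite /potential x0 ?prednK // mulr0 psC0 scale0r addr0 /quad.
  rewrite big1 ?scaler0 // => i _.
  by rewrite big1 // => j ij; rewrite x0 // psC0 scale0r.
by rewrite D_cst0 mul0r scaler0 !addr0.
Qed.

Lemma polar_in_Lu x : in_Lu x -> polar x = 0.
Proof.
move=> x0; rewrite /polar big1 // => a _; rewrite big1 // => i _.
by rewrite /epsc x0 // mcoeff0 psC0 scale0r.
Qed.

Lemma fock_op_in_Lu1 x : in_Lu x -> fock_op x 1 = psX K *: potential x.
Proof. by move=> x0; rewrite /fock_op polar_in_Lu // D1 mul0r !add0r mulr1. Qed.

(** This applies to the radical of the pairing, in particular to the image of
    the differential and to all odd elements. *)
Lemma fock_op_radical x : (forall a i, (i < n)%N -> epsc x a i = 0) ->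
  forall p, fock_op x p = 0.
Proof.
move=> x0 p; rewrite /fock_op.
have -> : polar x = 0.
  rewrite /polar big1 // => a _; rewrite big1 // => i _.
  by rewrite x0 ?psC0 ?scale0r.
have -> : hol x = fun=> 0.
  apply/funext => v; rewrite /hol x0 ?mulr0 ?psC0 //.
  by have := ltn_ord v.2; lia.
have -> : potential x = 0.
  rewrite /potential /quad big1 => [|i _]; last first.
    by rewrite big1 // => j ij; rewrite x0 // psC0 scale0r.
  by rewrite x0 ?prednK // mulr0 psC0 scale0r scaler0 addr0.
by rewrite D_cst0 !mul0r scaler0 !addr0.
Qed.

Lemma fock_op_var v p : fock_op (fock_var K v) p = X v * p.
Proof.
rewrite fock_op_regular => [|a a0 i ni]; last first.
  by rewrite epsc_fock_var // (_ : (a == _) = false) //; lia.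
congr (_ * _); set x := fock_var K v.
have vN : (v.1 < maxn (pole_order x) v.1.+1)%N by lia.
rewrite (@polarE (maxn (pole_order x) v.1.+1)) ?leq_maxl //.
rewrite (bigD1 (Ordinal vN)) //= (bigD1 v.2) //= epsc_fock_var //.
rewrite !eqxx psC1 scale1r [X in _ + X + _]big1 => [|i iv].
  rewrite [X in _ + _ + X]big1 => [|a av]; first by rewrite !addr0; case: (v).
  rewrite big1 // => i _; rewrite epsc_fock_var //.
  rewrite (_ : (_ == _) = false) ?psC0 ?scale0r //.
  by apply: contraNF av => /eqP E; apply/eqP/val_inj => /=; lia.
rewrite epsc_fock_var // (_ : (_ == _ :> nat) = false) ?andbF ?psC0 ?scale0r //.
by apply: contraNF iv => /eqP E; apply/eqP/val_inj.
Qed.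

Definition act (w : seq (laurent K)) (p : V) : V := foldr fock_op p w.

(** The action of the free algebra by which classes in the deformed Fock
    module are detected. *)
Definition rep (z : freeW K) (p : V) : V :=
  ext (fun w : {fmonom laurent K} => act (w : seq _) p) z.

Lemma act_lin a w p q : act w (a *: p + q) = a *: act w p + act w q.
Proof. by elim: w => //= x w ->; rewrite fock_op_lin. Qed.

Lemma actZ a w p : act w (a *: p) = a *: act w p.
Proof.
have act0 : act w 0 = 0.
  by have := act_lin (-1) w 0 0; rewrite scaler0 addr0 scaleN1r addNr.
by rewrite -[a *: p]addr0 act_lin act0 addr0.
Qed.

Lemma repD z z' p : rep (z + z') p = rep z p + rep z' p.
Proof. exact: extD. Qed.

Lemma repZ a z p : rep (a *: z) p = a *: rep z p.
Proof. exact: extZ. Qed.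

Lemma rep0 p : rep 0 p = 0.
Proof. exact: ext0. Qed.

Lemma repN z p : rep (- z) p = - rep z p.
Proof. by rewrite -scaleN1r repZ scaleN1r. Qed.

Lemma repB z z' p : rep (z - z') p = rep z p - rep z' p.
Proof. by rewrite [LHS]repD [X in _ + X]repN. Qed.

Lemma rep_gen x p : rep (gen x) p = fock_op x p.
Proof. by rewrite /rep /gen extU scale1r fmU. Qed.

Lemma rep_scal r p : rep (scalW r) p = r *: p.
Proof. by rewrite /rep /scalW extU fm1. Qed.

Lemma rep1 p : rep 1 p = p.
Proof. by rewrite -[RHS]scale1r -rep_scal. Qed.

Lemma repN1 p : rep (-1) p = - p.
Proof. by rewrite [LHS]repN rep1. Qed.

Lemma fock_op0 x : fock_op x 0 = 0.
Proof.
by have := fock_op_lin (-1) x 0 0; rewrite scaler0 addr0 scaleN1r addNr.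
Qed.

Lemma rep_lin a z p q : rep z (a *: p + q) = a *: rep z p + rep z q.
Proof.
rewrite /rep /ext scaler_sumr -big_split; apply: eq_bigr => w _.
by rewrite act_lin scalerDr !scalerA mulrC.
Qed.

Lemma repr0 z : rep z 0 = 0.
Proof. by have := rep_lin (-1) z 0 0; rewrite scaler0 addr0 scaleN1r addNr. Qed.

Lemma repZr a z p : rep z (a *: p) = a *: rep z p.
Proof. by rewrite -[a *: p]addr0 rep_lin repr0 addr0. Qed.

Lemma repM z z' p : rep (z * z') p = rep z (rep z' p).
Proof.
apply: (@action_of_basis _ _ (pser K * {fmonom laurent K})%type
  (fun t => << t.1 *g t.2 >>)) => [P P0 PD PU|||[a w] [b w'] q].
- by apply: malg_ind => // a t; exact: (PU (a, t)).
- exact: repD.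
- by move=> x q q'; rewrite -[q]scale1r rep_lin !scale1r.
rewrite malgM_def fgmulUU /rep !extU fmM /act foldr_cat.
by rewrite /= -/(act w' q) -/(act w (b *: act w' q)) actZ scalerA.
Qed.

Lemma rep_sum J r (P : pred J) (F : J -> freeW K) p :
  rep (\sum_(j <- r | P j) F j) p = \sum_(j <- r | P j) rep (F j) p.
Proof.
exact: (big_morph (fun z => rep z p) (fun z z' => repD z z' p) (rep0 p)).
Qed.

(** The variable u^-1 c, or 0 if c is in the radical. *)
Definition xvar (c : cell) : V :=
  \sum_(i < n) psC ((cellC K c)@_(epsA, i : nat)) *: X (0%N, i).

Lemma xvar_unit m : xvar (unitA, m) = 0.
Proof. by rewrite /xvar big1 // => i _; rewrite mcoeffU psC0 scale0r. Qed.

Lemma xvar_eps (i : 'I_n) : xvar (epsA, i : nat) = X (0%N, i).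
Proof.
rewrite /xvar (bigD1 i) //= mcoeffUU psC1 scale1r big1 ?addr0 // => j ji.
rewrite mcoeffU xpair_eqE eqxx /= (_ : (_ == _) = false) ?psC0 ?scale0r //.
by apply: contraNF ji => /eqP ij; apply/eqP/val_inj.
Qed.

Lemma fock_op_um1 c p : fock_op (lmono (-1) (cellC K c)) p = xvar c * p.
Proof.
rewrite fock_op_regular => [|a a0 i _]; last first.
  by rewrite /epsc /= (_ : (a == -1) = false) ?mcoeff0 //; lia.
congr (_ * _); set x := lmono _ _.
rewrite (@polarE (pole_order x).+1) // big_ord_recl.
rewrite [X in _ + X]big1 ?addr0 => [|a _].
  by apply: eq_bigr => i _; rewrite /epsc /= ?eqxx.
have xa : x (- (lift ord0 a).+1%:Z) = 0.
  change ((if - (lift ord0 a).+1%:Z == -1 then cellC K c else 0) = 0).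
  by rewrite lift0 (_ : (_ == _) = false) //; lia.
by rewrite big1 // => i _; rewrite /epsc xa mcoeff0 psC0 scale0r.
Qed.

(** Terms of the coproduct with a unit in an output act by zero, and those of
    eps|eps^k are the products of variables with indices of sum k. *)
Lemma rep_T1 (x : chain K) p : (forall k, (n <= k)%N -> x@_(epsA, k) = 0) ->
  rep (T1 n x) p =
  psC 2^-1 *: (\sum_(i < n) \sum_(j < n | (i + j < n)%N)
     psC (x@_(epsA, i + j)%N) *: (X (0%N, i) * X (0%N, j))) * p.
Proof.
move=> xn; rewrite /T1 repM rep_scal -scalerAl; congr (_ *: _).
pose h (c : cell * cell) (a : K) : V := psC a *: (xvar c.1 * xvar c.2).
have h0 c : h c 0 = 0 by rewrite /h psC0 scale0r.
have hD c a b : h c (a + b) = h c a + h c b by rewrite /h psCD scalerDl.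
have hZ (a : K) z : addext h (a *: z) = psC a *: addext h z.
  rewrite (addextEw h0 (msuppZ_le a z)) scaler_sumr; apply: eq_bigr => c _.
  by rewrite mcoeffZ /h psCM scalerA.
transitivity (addext h (coproduct n x) * p).
  rewrite rep_sum mulr_suml; apply: eq_bigr => c _.
  by rewrite repM rep_scal repM !rep_gen !fock_op_um1 /h -scalerAl mulrA.
congr (_ * _); rewrite /coproduct addext_sum //.
under eq_bigr => c _ do rewrite hZ.
rewrite (@sum_msupp_eps _ n _ x); first last.
- by move=> i ->; rewrite psC0 scale0r.
- case=> [] [] k kx /=; last first.
    rewrite -leqNgt => nk; move: kx; rewrite -mcoeff_neq0.
    by rewrite xn ?eqxx.
  move=> _; rewrite /addext big1 ?scaler0 // => -[[[] i] [[] j]] _ /=.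
  - by rewrite /h xvar_unit mul0r scaler0.
  - by rewrite /h xvar_unit mul0r scaler0.
  - by rewrite /h xvar_unit mulr0 scaler0.
  by rewrite coproduct_cell_unit h0.
pose F i j := psC (x@_(epsA, (i + j)%N)) *: (xvar (epsA, i) * xvar (epsA, j)).
transitivity (\sum_(k < n) \sum_(t < k.+1) F t (k - t)%N).
  apply: eq_bigr => k _; have [c ->] := coproduct_cell_eps K (ltn_ord k).
  rewrite addextD // addext_sum // hZ addextU // /h /= xvar_unit.
  rewrite mul0r !scaler0 addr0.
  rewrite scaler_sumr; apply: eq_bigr => t _.
  by rewrite addextU //= psC1 scale1r /F subnKC // -ltnS.
rewrite triangle; apply: eq_bigr => i _; apply: eq_bigr => j _.
by rewrite /F !xvar_eps.
Qed.

Hypothesis tauE : tau = 24%:R^-1 * rho_cell G2 K n (epsA, n.-1).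

Lemma rep_Trel (x : laurent K) : in_Lu x -> ldiff n x = 0 ->
  forall p, rep (Trel n x) p = potential x * p.
Proof.
move=> x0 dx p.
transitivity
  (rep (T1 n (x 0)) p + rep (T2 n (x 1)) p + rep (T3 n (x 0)) p).
  by rewrite /Trel [LHS]repD [X in X + _ = _]repD.
rewrite rep_T1; last by move=> k; exact: closed_eps.
rewrite [X in _ + X + _]rep_scal [X in _ + X]rep_scal rho_G3E rho_G2E //.
rewrite mulr0 psC0 scale0r addr0.
rewrite /potential mulrDl -scalerAl; congr (_ + _).
rewrite -scalerAl mul1r tauE /epsc; congr (psC _ *: _); ring.
Qed.

Lemma rep_weyl z : weyl_rel n z -> forall p, rep z p = 0.
Proof.
case=> [x y|a x|s t x y xs yt] p.
- transitivity (fock_op (x + y) p - fock_op x p - fock_op y p).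
    rewrite [LHS]repB [X in X - _]repB; congr (_ - _ - _); exact: rep_gen.
  by rewrite -[x]scale1r fock_op_arg_lin !scale1r addrAC addrK subrr.
- transitivity (fock_op (a *: x) p - psC a *: fock_op x p).
    rewrite [LHS]repB; congr (_ - _); first exact: rep_gen.
    by rewrite [LHS]repM [LHS]rep_scal; congr (_ *: _); exact: rep_gen.
  rewrite -[a *: x]addr0 fock_op_arg_lin (@fock_op_radical 0) ?addr0 ?subrr //.
  move=> b i _.
  by rewrite /epsc mcoeff0.
have odd_op u : homogeneous true u -> forall q, fock_op u q = 0.
  by move=> uo; apply: fock_op_radical => a i _; exact: uo.
transitivity (fock_op x (fock_op y p)
    - (-1) ^+ (s && t) *: fock_op y (fock_op x p)
    - psC (res_hres n x y) *: p).
  have rep_word u v q : rep (gen u * gen v) q = fock_op u (fock_op v q).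
    by rewrite [LHS]repM [X in rep _ X]rep_gen [LHS]rep_gen.
  rewrite [LHS]repB [X in X - _]repB; congr (_ - _ - _).
  - exact: rep_word.
  - rewrite [LHS]repM rep_word; case: (s && t).
      by rewrite !expr1 repN1 scaleN1r.
    by rewrite !expr0 rep1 scale1r.
  exact: rep_scal.
have [st|] := boolP (s || t); last first.
  by case: s t {xs yt} => [] [] //= _; rewrite expr0 scale1r fock_op_comm subrr.
(* An odd generator acts by zero, hence pairs to zero with everything. *)
have [xy0 yx0] : fock_op x (fock_op y p) = 0 /\ fock_op y (fock_op x p) = 0.
  case/orP: st => [su|tu].
    by rewrite su in xs; rewrite !(odd_op _ xs) fock_op0.
  by rewrite tu in yt; rewrite !(odd_op _ yt) fock_op0.
by rewrite -fock_op_comm xy0 yx0 scaler0 !subr0.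
Qed.

Lemma rep_lamM z p : rep (lam K * z) p = psX K *: rep z p.
Proof. by rewrite [LHS]repM [LHS]rep_scal. Qed.

Lemma rep_lam2M z p : rep (lam K ^+ 2 * z) p = psX K ^+ 2 *: rep z p.
Proof. by rewrite expr2 -mulrA [LHS]rep_lamM [X in _ *: X]rep_lamM scalerA. Qed.

(** The relations of the Fock module hold on the vacuum 1 modulo lambda^2, the
    order up to which they are specified. *)
Lemma rep_null z : fock_null n z -> exists q, rep z 1 = psX K ^+ 2 *: q.
Proof.
elim=> [|z1 z2 _ [q1 E1] _ [q2 E2]|z1 r z2 rr|z1 x r x0 dx|z1 x r x0].
- by exists 0; rewrite rep0 scaler0.
- by exists (q1 + q2); rewrite [LHS]repD E1 E2 scalerDr.
- by exists 0; rewrite [LHS]repM [LHS]repM (rep_weyl rr) repr0 scaler0.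
- exists (rep z1 (rep r 1)); rewrite [LHS]repM.
  suff -> : rep (gen x - lam K * Trel n x + lam K ^+ 2 * r) 1
            = psX K ^+ 2 *: rep r 1.
    exact: repZr.
  rewrite [LHS]repD [X in X + _]repB [X in _ + X]rep_lam2M [X in X - _]rep_gen.
  rewrite [X in _ - X + _]rep_lamM (rep_Trel x0 dx) fock_op_in_Lu1 // mulr1.
  by rewrite subrr add0r.
exists (rep z1 (potential x + rep r 1)); rewrite [LHS]repM.
suff -> : rep (lam K * gen x + lam K ^+ 2 * r) 1
          = psX K ^+ 2 *: (potential x + rep r 1).
  exact: repZr.
rewrite [LHS]repD [X in _ + X]rep_lam2M [X in X + _]rep_lamM.
rewrite [X in _ *: X + _]rep_gen.
by rewrite fock_op_in_Lu1 // scalerA -expr2 [RHS]scalerDr.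
Qed.

(** Applied to a word, the differential replaces one letter by an element of
    the radical. *)
Lemma rep_diff z p : rep (diffW n z) p = 0.
Proof.
rewrite /diffW [LHS]rep_sum big1 // => w _; rewrite [LHS]repM [LHS]rep_scal.
rewrite /diff_word [X in _ *: X]rep_sum big1 ?scaler0 // => i _.
rewrite -mulrA [LHS]repM [X in rep _ X]repM [X in rep _ X]rep_gen.
rewrite fock_op_radical ?repr0 //.
by move=> a j _; exact: epsc_ldiff.
Qed.

Lemma rep_prod (s : seq (fockVar n)) (e : fockVar n -> nat) p :
  rep (\prod_(v <- s) gen (fock_var K v) ^+ e v) p =
  (\prod_(v <- s) X v ^+ e v) * p.
Proof.
elim: s => [|v s IH]; first by rewrite !big_nil rep1 mul1r.
rewrite !big_cons [LHS]repM IH -mulrA; move: (_ * p) => q.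
elim: (e v) => [|m IHm]; first by rewrite !expr0 rep1 mul1r.
by rewrite !exprS [LHS]repM IHm [LHS]rep_gen fock_op_var mulrA.
Qed.

Lemma rep_eval (P : fockPoly K n) :
  rep (fock_eval P) 1 =
  \sum_(m <- msupp P) P@_m *: \prod_(v <- finsupp (cmonom_val m)) X v ^+ m v.
Proof.
rewrite /fock_eval [LHS]rep_sum; apply: eq_bigr => m _.
by rewrite [LHS]repM [LHS]rep_scal; congr (_ *: _); rewrite rep_prod mulr1.
Qed.

(** The first order part of the class of the lift is its potential. The graph
    G2 drops out of it, since its term of order u is a multiple of
    eps|eps^(k+n+1) and k + n + 1 > n - 1. *)
Lemma eval_of_homologous (k : nat) (P : fockPoly K n) : (k < n)%N ->
  fock_homologous n (gen (split_lift K n k)) (fock_eval P) ->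
  exists (c : 'I_n -> 'I_n -> pser K) q,
    \sum_(m <- msupp P) P@_m *: \prod_(v <- finsupp (cmonom_val m)) X v ^+ m v =
    psX K *: (\sum_(i < n) \sum_(j < n) c i j *: (X (0%N, i) * X (0%N, j)))
    + psX K ^+ 2 *: q.
Proof.
move=> kn [t /rep_null[q]]; rewrite [LHS]repB rep_diff subr0 [LHS]repB.
rewrite rep_gen rep_eval.
rewrite fock_op_in_Lu1; last by case.
move=> E; exists (fun i j => if (i + j < n)%N then
  psC (2^-1 * epsc (split_lift K n k) 0 (i + j)) else 0), (- q).
rewrite scalerN -E opprB; set S := (X in psX K *: X + _).
suff -> : S = potential (split_lift K n k) by rewrite addrC subrK.
have c1 : epsc (split_lift K n k) 1 n.-1 = 0.
  rewrite /epsc /= mcoeffZ mcoeffU xpair_eqE eqxx /=.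
  by rewrite (_ : (_ == _) = false) ?mulr0 //; lia.
rewrite /potential c1 mulr0 psC0 scale0r addr0 scaler_sumr; apply: eq_bigr => i _.
rewrite scaler_sumr [RHS]big_mkcond; apply: eq_bigr => j _.
by case: ifP => _; rewrite ?scale0r // scalerA psCM.
Qed.

End Operators.

(** * Uniqueness of the invariant *)

Section Unique.
Variables (K : fieldType) (n : nat).
Hypothesis charK : [pchar K] =i pred0.
Hypothesis n_gt0 : (0 < n)%N.

(** The representation on the polynomials themselves recovers P from its
    class. To first order P is then a quadratic form, without constant term. *)
Lemma costello11_eq0 k (v : K) : (k < n)%N -> is_costello11 n k v -> v = 0.
Proof.
move=> kn [P [hom ->]].
pose X : fockVar n -> fockPoly K n := var (pser K : comNzRingType).
pose D : (fockVar n -> pser K) -> fockPoly K n -> fockPoly K n :=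
  @der (fockVar n) (pser K).
have ind := @polyvar_ind (fockVar n) (pser K).
have DD := @derD (fockVar n) (pser K).
have DZ := @derZ (fockVar n) (pser K).
have DM := @derM (fockVar n) (pser K).
have DX := @der_var (fockVar n) (pser K).
have [c [q E]] := @eval_of_homologous K n charK n_gt0 (fockPoly K n) X D
  ind DD DZ DM DX _ erefl k P kn hom.
have PE : P = \sum_(m <- msupp P)
    P@_m *: \prod_(v <- finsupp (cmonom_val m)) var (pser K) v ^+ m v.
  rewrite {1}[P]monalgE; apply: eq_bigr => m _.
  by rewrite monalgUZ monomE.
have {E PE} := etrans PE E; set Q := (X in psX K *: X) => PE.
have Q0 : mcoeff (@mone {cmonom (fockVar n)}) Q = 0.
  rewrite /Q mcoeff_sum big1 // => i _; rewrite mcoeff_sum big1 // => j _.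
  rewrite [LHS]mcoeffZ -[X in mcoeff _ X]monalgUM [X in _ * X]mcoeffU.
  by rewrite cmM_eq1 cm1_eq1 mulr0n mulr0.
rewrite PE [X in X 1%N]mcoeffD coef_psD [X in X 1%N + _]mcoeffZ Q0 mulr0 add0r.
by rewrite [X in X 1%N]mcoeffZ expr2 -mulrA coef_psXM coef_psXM0.
Qed.

End Unique.

(** * The class of the lift *)

Section LeftIdeal.
Variables (W : nzRingType) (N : W -> Prop).
Hypothesis N0 : N 0.
Hypothesis ND : forall x y, N x -> N y -> N (x + y).
Hypothesis NM : forall z x, N x -> N (z * x).

Lemma idealN x : N x -> N (- x).
Proof. by rewrite -mulN1r; exact: NM. Qed.

Lemma ideal_trans y x z : N (x - y) -> N (y - z) -> N (x - z).
Proof. by move=> /ND h /h; rewrite addrA subrK. Qed.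

Lemma ideal_sym x y : N (x - y) -> N (y - x).
Proof. by move/idealN; rewrite opprB. Qed.

Lemma ideal_sum I r (P : pred I) (F G : I -> W) :
  (forall i, P i -> N (F i - G i)) ->
  N (\sum_(i <- r | P i) F i - \sum_(i <- r | P i) G i).
Proof. by move=> FG; rewrite -sumrB; elim/big_ind: _. Qed.

(** Multiplied by the central element l, the differences r and r' of the
    factors are in the left ideal when they stand at the right end of a word;
    the commutation of r with y' brings r there. *)
Lemma ideal_mul2 l x x' y y' r r' :
  (forall z, l * z = z * l) ->
  (forall z', N ((y - x - r) * z')) -> N (y' - x' - r') ->
  N (l * r) -> N (l * r') -> N (r * y' - y' * r) ->
  N (l * (y * y') - l * (x * x')).
Proof.
move=> lC Ny Ny' Nr Nr' Nc.
apply: (@ideal_trans (l * ((x + r) * y'))).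
  by rewrite -mulrBr -mulrBl opprD addrA; exact: NM.
rewrite mulrDl mulrDr addrAC; apply: ND.
  apply: (@ideal_trans (l * (x * (x' + r')))).
    by rewrite -mulrBr -mulrBr opprD addrA; do 2!apply: NM.
  rewrite mulrDr mulrDr addrAC subrr add0r mulrA lC -mulrA; exact: NM.
rewrite -[l * _](subrK (l * (y' * r))); apply: ND.
  by rewrite -mulrBr; exact: NM.
by rewrite mulrA lC -mulrA; exact: NM.
Qed.

Lemma ideal_even_comm (x y s : W) : s = 0 ->
  N (x * y - (-1) ^+ (false && false) * (y * x) - s) -> N (x * y - y * x).
Proof. by move=> ->; rewrite subr0 expr0 mul1r. Qed.

Lemma ideal_odd_sq (h x s : W) : h *+ 2 = 1 -> s = 0 ->
  N (x * x - (-1) ^+ (true && true) * (x * x) - s) -> N (x * x).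
Proof.
move=> h2 ->; rewrite subr0 expr1 mulN1r opprK => /(NM h).
by rewrite -mulr2n mulrnAr -mulrnAl h2 mul1r.
Qed.

Lemma ideal_eq (x y : W) : x = y -> N (x - y).
Proof. by move=> ->; rewrite subrr. Qed.

Lemma ideal_scaled_sum I r (l s c u : W) (M : I -> W) : l * s = s * l -> N u ->
  N (l * (s * (\sum_(t <- r) M t + c * u)) - \sum_(t <- r) s * (l * M t)).
Proof.
move=> ls Nu; rewrite -!mulr_sumr !mulrDr !mulrA ls addrAC subrr add0r.
exact: NM.
Qed.

Lemma ideal_first_order (x y : W) : N (1 * (x + y * 0)) -> N x.
Proof. by rewrite mul1r mulr0 addr0. Qed.

End LeftIdeal.

Section Null.
Variables (K : fieldType) (n : nat).
Notation null := (@fock_null K n).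
Implicit Types (a : pser K) (z : freeW K).

Lemma scalWD a b : scalW (a + b) = scalW a + scalW b.
Proof. exact: monalgUD. Qed.

Lemma scalW0 : scalW (0 : pser K) = 0.
Proof. exact: monalgU0. Qed.

Lemma scalWM a b : scalW (a * b) = scalW a * scalW b.
Proof. by rewrite /scalW [RHS]malgM_def [RHS]fgmulUU mulm1. Qed.

Lemma scalW1 : scalW (1 : pser K) = 1.
Proof. by []. Qed.

Lemma scalW_central a z : scalW a * z = z * scalW a.
Proof.
rewrite [LHS]mul_malgC [RHS]malgM_def [RHS]fgmulgU; apply: eq_bigr => w _.
by rewrite mulrC mulm1.
Qed.

Lemma null_mul y z : null z -> null (y * z).
Proof.
elim=> [|z1 z2 _ N1 _ N2|z1 r z2 rr|z1 x r x0 dx|z1 x r x0].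
- by rewrite mulr0; exact: fock_zero.
- by rewrite mulrDr; exact: fock_add.
- by rewrite !mulrA; exact: fock_weyl.
- by rewrite mulrA; exact: fock_closed.
by rewrite mulrA; exact: fock_order0.
Qed.

Lemma null_weyl r z' : weyl_rel n r -> null (r * z').
Proof. by move=> rr; rewrite -[r]mul1r; exact: fock_weyl. Qed.

Lemma null_weyl0 r : weyl_rel n r -> null r.
Proof. by move=> rr; rewrite -[r]mulr1; exact: null_weyl. Qed.

Lemma null_lam x : in_Lu x -> null (lam K * gen x).
Proof.
move=> x0; have h := @fock_order0 K n 1 x 0 x0.
exact: (@ideal_first_order _ null _ _ h).
Qed.

Hypothesis charK : [pchar K] =i pred0.
Hypothesis n_gt0 : (0 < n)%N.

(** Regular modulo the radical of the residue pairing; any two such elements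
    commute. *)
Definition regular (x : laurent K) : Prop :=
  forall (a : int) i, 0 <= a -> (i < n)%N -> epsc x a i = 0.

Lemma res_hres_regular x y : regular x -> regular y -> res_hres n x y = 0.
Proof.
move=> xr yr; set N := maxn (pole_order x) (pole_order y).
rewrite (@res_hresE _ _ charK N) ?leq_maxl ?leq_maxr // /half_res.
rewrite !big1 ?subrr // => a _.
  by rewrite big1 // => i _; rewrite yr ?mulr0 ?mul0r //; have := ltn_ord i; lia.
by rewrite big1 // => i _; rewrite xr ?mulr0 ?mul0r //; have := ltn_ord i; lia.
Qed.

Lemma null_comm x y : homogeneous false x -> homogeneous false y ->
  regular x -> regular y -> null (gen x * gen y - gen y * gen x).
Proof.
move=> xe ye xr yr; apply: ideal_even_comm (null_weyl0 (weyl_comm n xe ye)).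
by rewrite res_hres_regular // psC0 scalW0.
Qed.

(** The Weyl relation for an odd generator with itself reads 2 x^2 = 0. *)
Lemma null_odd_sq x : homogeneous true x -> null (gen x * gen x).
Proof.
move=> xo; have xr : regular x by move=> a i _ _; exact: xo.
apply: (ideal_odd_sq null_mul (h := scalW (psC 2^-1)))
  (null_weyl0 (weyl_comm n xo xo)).
  have half2 : 2^-1 + 2^-1 = 1 :> K.
    have two_neq0 := natS_neq0 charK 1.
    by apply: (mulfI two_neq0); rewrite mulrDr divff // mulr1.
  by rewrite mulr2n -scalWD -psCD half2 psC1 scalW1.
by rewrite res_hres_regular // psC0 scalW0.
Qed.

Lemma null_add x y z' : null ((gen (x + y) - gen x - gen y) * z').
Proof. apply: null_weyl; exact: weyl_add. Qed.

Definition um1 (c : cell) : laurent K := lmono (-1) (cellC K c).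

Lemma homogeneous_um1 c : homogeneous c.1 (um1 c).
Proof.
move=> a d dc /=; case: eqP => _; last by rewrite mcoeff0.
by rewrite mcoeffU (_ : (c == d) = false) //; apply: contraNF dc => /eqP ->.
Qed.

Lemma regular_um1 c : regular (um1 c).
Proof.
by move=> a i a0 _; rewrite /epsc /= (_ : (a == _) = false) ?mcoeff0 //; lia.
Qed.

Lemma homogeneous_fock_var (v : fockVar n) : homogeneous false (fock_var K v).
Proof.
move=> a [u m] um.
change ((split_lift K n v.2 (a - - (v.1.+1)%:Z))@_(u, m) = 0).
case: (a - _) => l /=; last by rewrite mcoeff0.
by rewrite mcoeffZ mcoeffU xpair_eqE; case: u um => //= _; rewrite mulr0.
Qed.

(** The terms of nonnegative order in u of the variable u^-1 (lift of
    eps|eps^i). *)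
Definition tail (i : 'I_n) : laurent K :=
  fock_var K (0%N, i) - um1 (epsA, i : nat).

Lemma tail_in_Lu i : in_Lu (tail i).
Proof.
move=> a a0.
change (split_lift K n i (a - - (1%N)%:Z)
        - (if a == -1 then cellC K (epsA, i : nat) else 0) = 0).
case: eqP => [->|a1].
  by rewrite addNr /= /split_coef big_ord0 muln0 !addn0 mul1r scale1r subrr.
by case E : (a - _) => [l|l] /=; [lia|rewrite subrr].
Qed.

Lemma homogeneous_tail i : homogeneous false (tail i).
Proof.
move=> a c cu; change ((fock_var K (0%N, i) a - um1 (epsA, i : nat) a)@_c = 0).
by rewrite mcoeffB homogeneous_fock_var // (@homogeneous_um1 (epsA, i : nat)) //
  subrr.
Qed.

Lemma regular_fock_var (v : fockVar n) : regular (fock_var K v).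
Proof.
by move=> a i a0 ni; rewrite epsc_fock_var // (_ : (a == _) = false) //; lia.
Qed.

Lemma regular_tail i : regular (tail i).
Proof.
move=> a j a0 nj.
change ((fock_var K (0%N, i) a - um1 (epsA, i : nat) a)@_(epsA, j) = 0).
by rewrite mcoeffB -!/(epsc _ _ _) regular_fock_var // regular_um1 // subrr.
Qed.

Notation fv i := (gen (fock_var K (0%N, i : 'I_n))).
Notation um i := (gen (um1 (epsA, nat_of_ord i))).

(** The tails commute with the variables, and lambda times a tail is in the
    left ideal; so to first order in lambda quadratic terms may be written in
    the classes of the splitting. *)
Lemma null_quad (i j : 'I_n) :
  null (lam K * (fv i * fv j) - lam K * (um i * um j)).
Proof.
have fvE k z' : null ((fv k - um k - gen (tail k)) * z').
  have -> : fock_var K (0%N, k) = um1 (epsA, k : nat) + tail k.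
    by rewrite addrC subrK.
  exact: null_add.
apply: (ideal_mul2 (@fock_add _ _) null_mul
          (r := gen (tail i)) (r' := gen (tail j))).
- exact: scalW_central.
- exact: fvE.
- by have := fvE j 1; rewrite [X in null X -> _]mulr1.
- exact: null_lam (tail_in_Lu i).
- exact: null_lam (tail_in_Lu j).
apply: null_comm.
- exact: homogeneous_tail.
- exact: homogeneous_fock_var.
- exact: regular_tail.
- exact: regular_fock_var.
Qed.

Lemma uniq2_cases (T : eqType) (s : seq T) x y : x != y -> uniq s ->
  s =i [:: x; y] -> s = [:: x; y] \/ s = [:: y; x].
Proof.
move=> xy us sE; have /perm_size : perm_eq s [:: x; y].
  by apply: uniq_perm => //=; rewrite inE xy.
case: s us sE => [|a [|b []]] //=; rewrite inE => /andP[ab _] sE _.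
have := sE a; have := sE b; rewrite !inE !eqxx orbT /=.
move=> /esym/orP[/eqP bx|/eqP byy] /esym/orP[/eqP ax|/eqP ay].
- by rewrite ax bx eqxx in ab.
- by right; rewrite ay bx.
- by left; rewrite ax byy.
by rewrite ay byy eqxx in ab.
Qed.

(** The order in which the support of a monomial is enumerated is unknown, so
    the two factors may have to be exchanged. *)
Lemma null_monomial (v w : fockVar n) :
  let m := @mmul {cmonom (fockVar n)} (ucm v) (ucm w) in
  null (\prod_(x <- finsupp (cmonom_val m)) gen (fock_var K x) ^+ m x
        - gen (fock_var K v) * gen (fock_var K w)).
Proof.
set m := mmul _ _; rewrite /=.
have [vw|vw] := eqVneq v w.
  have sE : finsupp m = [fset v]%fset by rewrite mdomD !mdomU vw fsetUid.
  apply: (ideal_eq (@fock_zero _ _)).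
  by rewrite sE big_seq_fset1 cmM !cmU -vw eqxx.
have mv : m v = 1%N by rewrite cmM !cmU eqxx eq_sym (negbTE vw).
have mw : m w = 1%N by rewrite cmM !cmU eqxx (negbTE vw).
have [|sE|sE] := @uniq2_cases _ (finsupp m) v w vw (fset_uniq _).
- by move=> x; rewrite /m mdomD !mdomU !inE.
- rewrite sE !big_cons big_nil mv mw !expr1 [X in _ * X - _]mulr1.
  exact: (ideal_eq (@fock_zero _ _)).
rewrite sE !big_cons big_nil mv mw !expr1 [X in _ * X - _]mulr1.
apply: null_comm; by [exact: homogeneous_fock_var|exact: regular_fock_var].
Qed.

Lemma linextU (U : lmodType K) (f : cell -> U) (a : K) c :
  linext f (a *: cellC K c) = a *: f c.
Proof.
change (ext f (a *: cellC K c) = a *: f c).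
by rewrite extZ /cellC extU scale1r.
Qed.

(** The term of order l + 1 of the lift is chosen so that its image under b
    cancels the image under B of the term of order l. *)
Lemma split_lift_closed k : (k < n)%N -> ldiff n (split_lift K n k) = 0.
Proof.
move=> kn; apply/val_inj/funext => i.
change (hochb n (split_lift K n k i) + connB (split_lift K n k (i - 1)) = 0).
have lift_neg l : split_lift K n k (Negz l) = 0 by [].
case: i => [[|l]|l]; first 1 last.
- rewrite [Posz _ - 1](_ : _ = Posz l); last by lia.
  rewrite /hochb /connB !linextU /b_cell /B_cell /=.
  rewrite (_ : (n <= _)%N = true); last by lia.
  rewrite (_ : (_ - n)%N = (k + n * l + l).+1); last by lia.
  rewrite scalerA -scalerDl /split_coef big_ord_recr /=.
  rewrite [X in X *: _](_ : _ = 0) ?scale0r //.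
  rewrite [in X in _ + X](_ : (k + n * l + l).+1 = k + 1 + l * n.+1)%N;
    last by lia.
  by rewrite exprS; ring.
- rewrite lift_neg (_ : Negz l - 1 = Negz l.+1); last by rewrite !NegzE; lia.
  by rewrite lift_neg /hochb /connB !linext0 addr0.
rewrite (_ : Posz 0 - 1 = Negz 0) // lift_neg /hochb /connB linext0 addr0.
rewrite linextU /b_cell /=.
by rewrite (_ : (n <= _)%N = false) ?scaler0 //; lia.
Qed.

(** On the lift the contributions of G2 and G3 vanish, and the coproduct
    gives the sum of the u^-1 eps|eps^t u^-1 eps|eps^(k-t), up to the square
    of the odd generator u^-1 1|eps^0. *)
Lemma null_Trel k (kn : (k < n)%N) :
  null (lam K * Trel n (split_lift K n k) -
        \sum_(t < k.+1) scalW (psC 2^-1) *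
          (lam K * (um (widen_ord kn t) * um (widen_ord kn (rev_ord t))))).
Proof.
set x := split_lift K n k.
have T23 : Trel n x = T1 n (x 0).
  rewrite /Trel /T2 /T3 rho_G3E mulr0 psC0 rho_G2E //.
  have -> : (x 1)@_(epsA, n.-1) = 0.
    rewrite /x /= mcoeffZ mcoeffU xpair_eqE (_ : (_ && _) = false) ?mulr0 //.
    by apply/negP => /andP[_ /eqP]; lia.
  by rewrite mul0r mulr0 psC0 scalW0 !addr0.
have x0 : x 0 = << (epsA, k) >>.
  by rewrite /x /= /split_coef big_ord0 mul1r scale1r /cellC muln0 !addn0.
pose h (c : cell * cell) (a : K) : freeW K :=
  scalW (psC a) * (gen (um1 c.1) * gen (um1 c.2)).
have h0 c : h c 0 = 0 by rewrite /h psC0 scalW0 mul0r.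
have hD c (a b : K) : h c (a + b) = h c a + h c b.
  by rewrite /h psCD scalWD mulrDl.
have [g copE] := coproduct_cell_eps K kn.
have copxE : coproduct n (x 0) = coproduct_cell K n (epsA, k).
  rewrite x0.
  change (ext (coproduct_cell K n) << (epsA, k) >>
          = coproduct_cell K n (epsA, k)).
  by rewrite extU scale1r.
have T1E : T1 n (x 0) = scalW (psC 2^-1) * addext h (coproduct n (x 0)) by [].
have cE : addext h (coproduct n (x 0)) =
    \sum_(t < k.+1) um (widen_ord kn t) * um (widen_ord kn (rev_ord t)) +
    scalW (psC g) * (gen (um1 (unitA, 0%N)) * gen (um1 (unitA, 0%N))).
  have hU t : addext h << ((epsA, t : nat), (epsA, (k - t)%N)) >> =
      gen (um1 (epsA, t)) * gen (um1 (epsA, (k - t)%N)).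
    by rewrite (addextU h0) /h psC1 scalW1; exact: mul1r.
  have hS : \sum_(t < k.+1) addext h << ((epsA, t : nat), (epsA, (k - t)%N)) >> =
      \sum_(t < k.+1) um (widen_ord kn t) * um (widen_ord kn (rev_ord t)).
    apply: eq_bigr => t _.
    rewrite [nat_of_ord (widen_ord kn (rev_ord t))](_ : _ = (k - t)%N).
      exact: hU.
    by rewrite /= subSS.
  rewrite copxE copE -monalgUZ (addextD h0 hD) (addext_sum h0 hD) (addextU h0).
  exact: (congr2 +%R hS (erefl _)).
rewrite T23 T1E cE; apply: (ideal_scaled_sum null_mul).
  exact: scalW_central.
by apply: null_odd_sq; exact: (@homogeneous_um1 (unitA, 0%N)).
Qed.

Lemma fock_evalE (I : Type) (r : seq I) (a : I -> pser K)
    (m : I -> {cmonom (fockVar n)}) :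
  fock_eval (\sum_(i <- r) << a i *g m i >>) =
  \sum_(i <- r) scalW (a i) *
    \prod_(v <- finsupp (cmonom_val (m i))) gen (fock_var K v) ^+ m i v.
Proof.
pose h (m : {cmonom (fockVar n)}) (b : pser K) : freeW K :=
  scalW b * \prod_(v <- finsupp (cmonom_val m)) gen (fock_var K v) ^+ m v.
have h0 c : h c 0 = 0 by rewrite /h scalW0 mul0r.
have hD c b b' : h c (b + b') = h c b + h c b' by rewrite /h scalWD mulrDl.
transitivity (addext h (\sum_(i <- r) << a i *g m i >>)); first by [].
by rewrite addext_sum //; apply: eq_bigr => i _; rewrite addextU.
Qed.

Lemma costello11_0 k : (k < n)%N -> is_costello11 n k (0 : K).
Proof.
move=> kn.
pose m (t : 'I_k.+1) : {cmonom (fockVar n)} :=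
  mmul (ucm (0%N, widen_ord kn t)) (ucm (0%N, widen_ord kn (rev_ord t))).
pose c : pser K := psC 2^-1 * psX K.
exists (\sum_(t < k.+1) << c *g m t >>); split; last first.
  rewrite mcoeff_sum big1 // => t _; rewrite mcoeffU cmM_eq1 cm1_eq1.
  by rewrite mulr0n.
exists 0; have -> : diffW n (0 : freeW K) = 0 by rewrite /diffW msupp0 big_nil.
rewrite subr0 fock_evalE.
have lift_rel :
    null (gen (split_lift K n k) - lam K * Trel n (split_lift K n k)).
  have lift_Lu : in_Lu (split_lift K n k) by case.
  have h := @fock_closed K n 1 _ 0 lift_Lu (split_lift_closed kn).
  exact: (@ideal_first_order _ null _ _ h).
apply: (ideal_trans (@fock_add _ _) lift_rel).
apply: (ideal_trans (@fock_add _ _) (null_Trel kn)).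
apply: (ideal_sum (@fock_zero _ _) (@fock_add _ _)) => t _.
rewrite /c scalWM -[X in _ - X]mulrA -[X in null X]mulrBr; apply: null_mul.
apply: (ideal_trans (@fock_add _ _) (y :=
    lam K * (fv (widen_ord kn t) * fv (widen_ord kn (rev_ord t))))).
  by apply: (ideal_sym null_mul); exact: null_quad.
rewrite -[X in null X]mulrBr; apply: null_mul; apply: (ideal_sym null_mul).
exact: null_monomial.
Qed.

End Null.

(* The invariant is well defined and equal to 0. *)
Theorem proposition2p6 (K : fieldType) (charK : [pchar K] =i pred0)
    (n k : nat) (n_gt0 : (1 <= n)%N) (lt_kn : (k <= n - 1)%N) (v : K) :
  is_costello11 n k v <-> v = 0.
Proof.
have kn : (k < n)%N by rewrite -(subnK n_gt0) addn1 ltnS.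
by split=> [|->]; [exact: costello11_eq0|exact: costello11_0].
Qed.
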